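(* The theory $T$ (the $\mathcal L$-theory with axioms (1)–(8') listed in the context) is dp-minimal.
   Context: Let $\mathcal L$ be the language with a binary function $+$, a binary relation $<$, a constant $0$, unary functions $s_q$ ($q\in\mathbb Q$), a unary predicate $P$, and binary predicates $R_n$ ($n\in\omega$, including $n=0$). $T$ is the $\mathcal L$-theory with the following axioms. (1) The usual axioms for a (nontrivial) ordered divisible Abelian group in $\{+,<,0\}$, and $s_q$ is scalar multiplication by $q$. (2) $0\in P$. (3) $x\in P$ if and only if $-x\in P$. (4) $P$ and $\neg P$ are open sets (in the order topology). (5) If $x\le y$ and $[x,y]\subseteq P$, then any $\mathbb Q$-linear combination $z$ of $x$ and $y$ with positive coefficients lies in the same connected (i.e. maximal convex) component of $P$ as $x$ and $y$. (5') If $x\le y$ and $[x,y]\subseteq\neg P$, then any $\mathbb Q$-linear combination $z$ of $x$ and $y$ with positive coefficients lies in the same connected component of $\neg P$ as $x$ and $y$. (6) $R_0$ is symmetric, and if $x\le y$ then $R_0(x,y)$ holds iff $[x,y]\subseteq P$ or $[x,y]\subseteq\neg P$. (7) For all $x,y$ and each positive $n<\omega$, $R_n(x,y)$ holds iff $x<y$ and there are exactly $n$ alternations of $P$ between $x$ and $y$; that is, either (A) $x\in P$ and there is a sequence $x=x_0<x_1<\dots<x_n=y$ with $x_i\in P$ iff $i$ is even, but there is no sequence $x=x_0<x_1<\dots<x_{n+1}\le y$ with $x_i\in P$ iff $i$ is even; or (B) $x\notin P$ and there is a sequence $x=x_0<x_1<\dots<x_n=y$ with $x_i\in P$ iff $i$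 is odd, but there is no sequence $x=x_0<x_1<\dots<x_{n+1}\le y$ with $x_i\in P$ iff $i$ is odd. (8) For any positive $x$ there is $y$ with $R_1(x,y)$. (8') For any positive $x$ there is $y$ with $R_1(y,x)$. An ICT pattern in a structure $M$ consists of formulae $\phi(x,\bar y)$, $\psi(x,\bar y)$, with $x$ a single variable and $\bar y$ a finite tuple of variables, and sequences $(\bar a_i)_{i\in\omega}$, $(\bar b_i)_{i\in\omega}$ of tuples from $M$ such that for all $i,j\in\omega$ the set $\{\phi(x,\bar a_i),\psi(x,\bar b_j)\}\cup\{\neg\phi(x,\bar a_l):l\neq i\}\cup\{\neg\psi(x,\bar b_k):k\neq j\}$ is consistent (realized in some elementary extension of $M$). A theory is dp-minimal if there is no ICT pattern in any of its models. *)

(* Defs.v *)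
From mathcomp Require Import all_boot all_order all_algebra.

Set Implicit Arguments.
Unset Strict Implicit.
Unset Printing Implicit Defensive.

(* The language L = {+, <, 0, s_q (q in rat), P, R_n (n in nat)}, with equality
   as a logical symbol.  Variables are natural numbers. *)

Inductive term : Type :=
| Var of nat
| Zero
| Plus of term & term
| Scal of rat & term.

#[local] Coercion Var : nat >-> term.

Inductive formula : Type :=
| Fls
| Eq of term & term
| Lt of term & term
| InP of term
| Rel of nat & term & term
| Imp of formula & formula
| And of formula & formula
| Or of formula & formula
| All of nat & formula
| Ex of nat & formula.

Definition Not (p : formula) : formula := Imp p Fls.
Definition Iff (p q : formula) : formula := And (Imp p q) (Imp q p).

Fixpoint term_vars (t : term) : seq nat :=
  match t with
  | Var i => [:: i]
  | Zero => [::]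
  | Plus s t => term_vars s ++ term_vars t
  | Scal _ t => term_vars t
  end.

Fixpoint free_vars (p : formula) : seq nat :=
  match p with
  | Fls => [::]
  | Eq s t | Lt s t | Rel _ s t => term_vars s ++ term_vars t
  | InP t => term_vars t
  | Imp p q | And p q | Or p q => free_vars p ++ free_vars q
  | All i p | Ex i p => [seq j <- free_vars p | j != i]
  end.

Record structure := Structure {
  carrier :> Type;
  zero_of : carrier;
  plus_of : carrier -> carrier -> carrier;
  scal_of : rat -> carrier -> carrier;
  lt_of : carrier -> carrier -> Prop;
  P_of : carrier -> Prop;
  R_of : nat -> carrier -> carrier -> Prop
}.

Definition update (A : Type) (v : nat -> A) (i : nat) (a : A) : nat -> A :=
  fun j => if j == i then a else v j.

Fixpoint eval (M : structure) (v : nat -> M) (t : term) : M :=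
  match t with
  | Var i => v i
  | Zero => zero_of M
  | Plus s t => plus_of (eval v s) (eval v t)
  | Scal q t => scal_of q (eval v t)
  end.

Fixpoint sat (M : structure) (v : nat -> M) (p : formula) : Prop :=
  match p with
  | Fls => False
  | Eq s t => eval v s = eval v t
  | Lt s t => lt_of (eval v s) (eval v t)
  | InP t => P_of (eval v t)
  | Rel n s t => R_of n (eval v s) (eval v t)
  | Imp p q => sat v p -> sat v q
  | And p q => sat v p /\ sat v q
  | Or p q => sat v p \/ sat v q
  | All i p => forall a : M, sat (update v i a) p
  | Ex i p => exists a : M, sat (update v i a) p
  end.

(* A set of axioms; an axiom with free variables would be read as its universal
   closure. *)
Definition theory := formula -> Prop.

Definition models (M : structure) (Th : theory) : Prop :=
  forall p, Th p -> forall v : nat -> M, sat v p.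

Definition elementary (M N : structure) (f : M -> N) : Prop :=
  forall (p : formula) (v : nat -> M), sat v p <-> sat (f \o v) p.

(* A formula phi(x, y_1, ..., y_k) has its free variables among 0, ..., k: the
   variable x is 0 and y_j is j. *)
Definition formula_in (k : nat) (p : formula) : Prop :=
  {subset free_vars p <= iota 0 k.+1}.

(* N |= p(c, f a_1, ..., f a_k); the value given to the variables beyond k is
   irrelevant when formula_in k p. *)
Definition holds_at (M N : structure) (f : M -> N) (k : nat) (p : formula)
    (c : N) (a : k.-tuple M) : Prop :=
  sat (fun i => nth c (c :: map f a) i) p.

Definition ICT_pattern (M : structure) (k : nat) (phi psi : formula)
    (a b : nat -> k.-tuple M) : Prop :=
  [/\ formula_in k phi,
      formula_in k psi &
      forall i j : nat, exists (N : structure) (f : M -> N),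
        elementary f /\
        exists c : N,
          [/\ holds_at f phi c (a i),
              holds_at f psi c (b j),
              forall l, l <> i -> ~ holds_at f phi c (a l) &
              forall m, m <> j -> ~ holds_at f psi c (b m)]].

Definition dp_minimal (Th : theory) : Prop :=
  forall M : structure, models M Th ->
  ~ exists (k : nat) (phi psi : formula) (a b : nat -> k.-tuple M),
      ICT_pattern phi psi a b.

Definition Le (s t : term) : formula := Or (Lt s t) (Eq s t).
Definition NotP (t : term) : formula := Not (InP t).
Definition Opp (t : term) : term := Scal (-1)%R t.
Definition Mult (n : nat) (t : term) : term := iter n (Plus t) Zero.

Definition Conj (ps : seq formula) : formula := foldr And (Not Fls) ps.
Definition Exs (xs : seq nat) (p : formula) : formula := foldr Ex p xs.

Declare Scope fo_scope.
Delimit Scope fo_scope with FO.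
Bind Scope fo_scope with term.
Bind Scope fo_scope with formula.
Notation "0" := Zero : fo_scope.
Notation "s + t" := (Plus s t) : fo_scope.
Notation "s = t" := (Eq s t) : fo_scope.
Notation "s < t" := (Lt s t) : fo_scope.
Notation "s <= t" := (Le s t) : fo_scope.
Notation "~ p" := (Not p) : fo_scope.
Notation "p -> q" := (Imp p q) : fo_scope.
Notation "p <-> q" := (Iff p q) : fo_scope.
Notation "p /\ q" := (And p q) : fo_scope.
Notation "p \/ q" := (Or p q) : fo_scope.
Notation "'ALL' i .. j , p" := (All i .. (All j p) ..)
  (at level 200, i at level 0, j at level 0, p at level 200, only parsing)
  : fo_scope.
Notation "'EX' i .. j , p" := (Ex i .. (Ex j p) ..)
  (at level 200, i at level 0, j at level 0, p at level 200, only parsing)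
  : fo_scope.

Local Notation vx := 0%N (only parsing).
Local Notation vy := 1%N (only parsing).
Local Notation vz := 2%N (only parsing).
Local Notation vw := 3%N (only parsing).

Local Open Scope fo_scope.

(* [s, t] is contained in A, for terms s, t in which vw does not occur. *)
Definition IntervalIn (A : term -> formula) (s t : term) : formula :=
  ALL vw, (s <= vw /\ vw <= t) -> A vw.

(* s and t lie in the same maximal convex subset of A: the closed interval with
   endpoints s and t, in either order, is contained in A. *)
Definition SameComponent (A : term -> formula) (s t : term) : formula :=
  ((s <= t) -> IntervalIn A s t) /\ ((t <= s) -> IntervalIn A t s).

(* A is open.  The bounded open intervals form a basis of the order topology,
   since a nontrivial ordered Abelian group has no endpoints. *)
Definition Open (A : term -> formula) : formula :=
  ALL vx, A vx ->
    EX vy vz, (vy < vx /\ vx < vz) /\ (ALL vw, (vy < vw /\ vw < vz) -> A vw).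

(* If x <= y and [x, y] is contained in A, then p x + q y lies in the same
   component of A as x and y. *)
Definition PosCombination (A : term -> formula) (p q : rat) : formula :=
  ALL vx vy, (vx <= vy /\ IntervalIn A vx vy) ->
    (SameComponent A (Plus (Scal p vx) (Scal q vy)) vx /\
     SameComponent A (Plus (Scal p vx) (Scal q vy)) vy).

(* The variable x_i of a sequence x_0 < x_1 < ..., distinct from vx and vy. *)
Definition seq_var (i : nat) : nat := (i + 2)%N.

(* There is a sequence x = x_0 < x_1 < ... < x_n such that [end_cond x_n] and,
   for all i <= n, x_i is in P iff i has parity b (b = true for odd). *)
Definition Alternates (b : bool) (n : nat) (end_cond : term -> formula)
  : formula :=
  Exs [seq seq_var i | i <- iota 0%N n.+1]
    ((vx = seq_var 0%N /\ end_cond (seq_var n)) /\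
     (Conj [seq Lt (seq_var i) (seq_var i.+1) | i <- iota 0%N n] /\
      Conj [seq (if odd i == b then InP (seq_var i) else NotP (seq_var i))
           | i <- iota 0%N n.+1])).

(* x < y and there are exactly n alternations of P between x and y. *)
Definition ExactAlternations (n : nat) : formula :=
  vx < vy /\
  ((InP vx /\ (Alternates false n (fun t => t = vy) /\
               ~ Alternates false n.+1 (fun t => t <= vy))) \/
   (NotP vx /\ (Alternates true n (fun t => t = vy) /\
                ~ Alternates true n.+1 (fun t => t <= vy)))).

Inductive T : theory :=
(* The theory of nontrivial ordered divisible Abelian groups; s_q is the scalar
   multiplication by q of the unique Q-vector space structure. *)
| T_addA : T (ALL vx vy vz, vx + (vy + vz) = (vx + vy) + vz)
| T_addC : T (ALL vx vy, vx + vy = vy + vx)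
| T_add0 : T (ALL vx, 0 + vx = vx)
| T_addN : T (ALL vx, EX vy, vx + vy = 0)
| T_ltxx : T (ALL vx, ~ (vx < vx))
| T_lt_trans : T (ALL vx vy vz, (vx < vy /\ vy < vz) -> vx < vz)
| T_lt_total : T (ALL vx vy, vx < vy \/ (vx = vy \/ vy < vx))
| T_lt_add : T (ALL vx vy vz, vx < vy -> vx + vz < vy + vz)
| T_divisible (n : nat) of (0 < n)%N : T (ALL vx, EX vy, Mult n vy = vx)
| T_nontrivial : T (EX vx, ~ (vx = 0))
| T_scal1 : T (ALL vx, Scal 1%R vx = vx)
| T_scalDr (q : rat) :
    T (ALL vx vy, Scal q (Plus vx vy) = Scal q vx + Scal q vy)
| T_scalDl (p q : rat) :
    T (ALL vx, Scal (p + q)%R vx = Scal p vx + Scal q vx)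
| T_scalA (p q : rat) : T (ALL vx, Scal (p * q)%R vx = Scal p (Scal q vx))
| T_P0 : T (InP 0)
| T_PN : T (ALL vx, InP vx <-> InP (Opp vx))
| T_P_open : T (Open InP)
| T_NotP_open : T (Open NotP)
| T_P_comb (p q : rat) of (0 < p)%R & (0 < q)%R : T (PosCombination InP p q)
| T_NotP_comb (p q : rat) of (0 < p)%R & (0 < q)%R :
    T (PosCombination NotP p q)
| T_R0_sym : T (ALL vx vy, Rel 0%N vx vy -> Rel 0%N vy vx)
| T_R0 : T (ALL vx vy, vx <= vy ->
    (Rel 0%N vx vy <-> (IntervalIn InP vx vy \/ IntervalIn NotP vx vy)))
| T_Rn (n : nat) of (0 < n)%N :
    T (ALL vx vy, Rel n vx vy <-> ExactAlternations n)
| T_R1_right : T (ALL vx, 0 < vx -> EX vy, Rel 1%N vx vy)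
| T_R1_left : T (ALL vx, 0 < vx -> EX vy, Rel 1%N vy vx).

(* Main.v *)
From HB Require Import structures.
From mathcomp Require Import all_boot all_order all_algebra boolp zify.
Require Import Defs.

Set Implicit Arguments.
Unset Strict Implicit.
Unset Printing Implicit Defensive.

(** Call a component a maximal convex subset of P or of its complement.  The
    positive combination axioms make every component to the right of 0 closed
    under addition and under multiplication by positive rationals.  Hence the
    component of |x|, its level, is a valuation: the level of a sum of two
    nonnegative elements is the larger of the two levels.  The levels form a
    discrete chain with a first and no last element, and P x says that the
    level of x is even.  This is the record [levels]; [component_levels] finds
    it in every model.

    A formula depends, for a suitable finite set of linear terms in its free
    variables, only on the signs of these terms, on the parities of their
    levels, and on the distances of their levels, cut off at a finite bound
    ([finitary_sat]).  This is a form of quantifier elimination, proved by going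
    back and forth: [match_point] answers one new point, and relies on
    [similar_extend], which answers one new level in the chain.  The relations
    R_n need no separate treatment since the axioms define them from < and P.

    For the parameters fixed, a formula phi(x, y) in the single variable x is
    therefore a Boolean combination of a bounded number of cuts and of
    translates p + P, with a bound N that does not depend on the parameters
    ([finitary_tame]).  The key fact is that such families have few traces: K
    cuts and translates together cut the line into O(K) classes ([tame_card]).
    Indeed, if q is the point nearest to p among finitely many given points,
    the translates p + P and q + P agree at x unless the level of x - p is at
    most that of p - q; when it is smaller, the trace of x on the old translates
    is constant, and when it is equal, x - p has a constant level.  So each new
    translate costs only the four cuts that bound the open and the closed ball
    around p through q ([two_colors_cuts]).

    An ICT pattern has, inside the model itself, all its finite subpatterns
    ([ICT_realized]).  A pattern with n rows and n columns gives n ^ 2 points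
    which are pairwise told apart by 2 n formulas, so by O(n) cuts and
    translates; for large n this contradicts the linear bound. *)

Import Order.TTheory GRing.Theory Num.Theory.
Local Open Scope ring_scope.

(** * Ordered rational vector spaces *)

HB.mixin Record POrderedLmodule_isTotallyOrdered V of
    Num.POrderedZmodule V & GRing.Lmodule rat V := {
  lt_translate : forall x y z : V, x < y -> x + z < y + z;
  comparable_all : forall x y : V, x >=< y
}.
#[short(type="orderedQmodType")]
HB.structure Definition OrderedQmod :=
  { V of Num.POrderedZmodule V & GRing.Lmodule rat V &
         POrderedLmodule_isTotallyOrdered V }.

Section OrderedQmodTheory.
Context (V : orderedQmodType).
Implicit Types (x y z : V) (q : rat).

Definition qleNgt x y := comparable_leNgt (comparable_all x y).
Definition qltNge x y := comparable_ltNge (comparable_all x y).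
Definition qleP x y := comparable_leP (comparable_all x y).
Definition qltgtP x y := comparable_ltgtP (comparable_all x y).

Lemma ltD2rE x y z : (x + z < y + z) = (x < y).
Proof.
apply/idP/idP => [h|]; last exact: lt_translate.
by rewrite -(addrK z x) -(addrK z y) lt_translate.
Qed.

Lemma leD2rE x y z : (x + z <= y + z) = (x <= y).
Proof. by rewrite !qleNgt ltD2rE. Qed.

Lemma sub_gt0E x y : (0 < y - x) = (x < y).
Proof. by rewrite -[RHS](ltD2rE _ _ (- x)) subrr. Qed.

Lemma sub_lt0E x y : (y - x < 0) = (y < x).
Proof. by rewrite -[RHS](ltD2rE _ _ (- x)) subrr. Qed.

Lemma sub_ge0E x y : (0 <= y - x) = (x <= y).
Proof. by rewrite !qleNgt sub_lt0E. Qed.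

Lemma opp_gt0E x : (0 < - x) = (x < 0).
Proof. by rewrite -{1}(add0r (- x)) sub_gt0E. Qed.

Lemma opp_lt0E x : (- x < 0) = (0 < x).
Proof. by rewrite -{1}(add0r (- x)) sub_lt0E. Qed.

Lemma opp_ge0E x : (0 <= - x) = (x <= 0).
Proof. by rewrite !qleNgt opp_lt0E. Qed.

Lemma ltN2E x y : (- x < - y) = (y < x).
Proof. by rewrite -[LHS]sub_gt0E opprK addrC sub_gt0E. Qed.

Lemma leB2lE x y z : (z - x <= z - y) = (y <= x).
Proof. by rewrite !(addrC z) leD2rE !qleNgt ltN2E. Qed.

Lemma add_gt0 x y : 0 < x -> 0 <= y -> 0 < x + y.
Proof.
move=> x0 y0; apply: (le_lt_trans y0).
by rewrite -{1}(add0r y) ltD2rE.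
Qed.

(** Only integer multiples are controlled by addition, so the rational scalar is
    cleared: d *: (q *: x) is a natural multiple of x for d the denominator. *)
Lemma scale_gt0 q x : 0 < q -> 0 < x -> 0 < q *: x.
Proof.
move=> q0 x0.
have natmul_gt0 (n : nat) y : 0 < y -> 0 < y *+ n.+1.
  move=> y0; elim: n => [|n IH]; first by rewrite mulr1n.
  by rewrite mulrS add_gt0 // ltW.
have nE : (`|numq q|%N%:R : rat) = (`|denq q|%N)%:R * q.
  rewrite !pmulrn !abszE ger0_norm ?numq_ge0 ?ltW // ger0_norm ?denq_ge0 //.
  by rewrite mulrC -numqE.
have num_gt0 : 0 < (`|numq q|%N%:R : rat) *: x.
  rewrite scaler_nat; case: (`|numq q|%N) (absz_eq0 (numq q)) => [|n _].
    by rewrite numq_eq0 (gt_eqF q0) eqxx.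
  exact: natmul_gt0.
move: num_gt0; rewrite nE -scalerA scaler_nat.
case: (`|denq q|%N) => [|d]; first by rewrite mulr0n ltxx.
case: (qltgtP 0 (q *: x)) => // [lt0|<-]; last by rewrite mul0rn ltxx.
have := natmul_gt0 d (- (q *: x)); rewrite opp_gt0E mulNrn opp_gt0E.
by move=> /(_ lt0) /ltW; rewrite qleNgt => /negbTE->.
Qed.

Lemma scale_gt0E q x : 0 < q -> (0 < q *: x) = (0 < x).
Proof.
move=> q0; apply/idP/idP; last exact: scale_gt0.
move=> h; rewrite -(scale1r x) -(mulVf (lt0r_neq0 q0)) -scalerA.
by rewrite scale_gt0 // invr_gt0.
Qed.

Lemma scale_lt0E q x : 0 < q -> (q *: x < 0) = (x < 0).
Proof. by move=> q0; rewrite -[LHS]opp_gt0E -scalerN scale_gt0E // opp_gt0E. Qed.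

Lemma scale_neg_gt0E q x : q < 0 -> (0 < q *: x) = (x < 0).
Proof. by move=> q0; rewrite -(opprK q) scaleNr opp_gt0E scale_lt0E // oppr_gt0. Qed.

Lemma scale_neg_lt0E q x : q < 0 -> (q *: x < 0) = (0 < x).
Proof. by move=> q0; rewrite -(opprK q) scaleNr opp_lt0E scale_gt0E // oppr_gt0. Qed.

Lemma sub_mid x y : 2^-1 *: (x + y) - x = 2^-1 *: (y - x).
Proof.
have xE : 2^-1 *: (x + x) = x by rewrite -mulr2n -scaler_nat scalerA mulVf ?scale1r.
by rewrite -{2}xE -scalerBr opprD addrA (addrC x y) addrK.
Qed.

Lemma half_lt x : 0 < x -> 2^-1 *: x < x.
Proof. by move=> x0; rewrite -sub_gt0E -{1}(scale1r x) -scalerBl scale_gt0E. Qed.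

End OrderedQmodTheory.

(** * Levels *)

(** [lev x] stands for the component of |x|.  Larger elements have larger levels,
    as for an absolute value that satisfies the ultrametric inequality, but many
    nonzero elements share the least level [lev 0].  The witness of [lev_onto]
    is positive also for that level, which lets a point be moved by an
    arbitrarily prescribed level in a prescribed direction. *)
Record levels (V : orderedQmodType) (P : V -> bool)
    (G : orderType ring_display) := Levels {
  lev : V -> G;
  suc : G -> G;
  par : G -> bool;
  lev_onto : forall g, exists2 x, 0 < x & lev x = g;
  levN : forall x, lev (- x) = lev x;
  levD : forall x y, 0 <= x -> 0 <= y -> lev (x + y) = Order.max (lev x) (lev y);
  levZ_pos : forall q x, 0 < q -> lev (q *: x) = lev x;
  lt_suc : forall g, g < suc g;
  suc_le : forall g h, g < h -> suc g <= h;
  suc_onto : forall g, lev 0 < g -> exists h, g = suc h;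
  par_suc : forall g, par (suc g) = ~~ par g;
  par_lev : forall x, P x = par (lev x)
}.

Section LevelTheory.
Context (V : orderedQmodType) (P : V -> bool) (G : orderType ring_display).
Context (L : levels P G).
Implicit Types (x y z p : V) (g h : G).
Local Notation lev := (lev L).
Local Notation suc := (suc L).

Lemma le_lev x y : 0 <= x -> x <= y -> lev x <= lev y.
Proof.
move=> x0 xy; rewrite -(subrK x y) levD ?sub_ge0E //.
by rewrite le_max lexx orbT.
Qed.

Lemma lev_abs x : exists2 y, 0 <= y & lev y = lev x /\ (y = x \/ y = - x).
Proof.
case: (qleP 0 x) => x0; first by exists x => //; split => //; left.
by exists (- x); rewrite ?opp_ge0E ?ltW // levN; split => //; right.
Qed.

Lemma lev0_le x : lev 0 <= lev x.
Proof. by have [y y0 [<- _]] := lev_abs x; rewrite le_lev. Qed.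

Lemma bot_le g : lev 0 <= g.
Proof. by have [x _ <-] := lev_onto L g; apply: lev0_le. Qed.

Lemma lev_subC x y : lev (x - y) = lev (y - x).
Proof. by rewrite -levN opprB. Qed.

Lemma levZ q x : q != 0 -> lev (q *: x) = lev x.
Proof.
case: (ltgtP q 0) => // q0 _; last by rewrite levZ_pos.
by rewrite -levN -scaleNr levZ_pos // oppr_gt0.
Qed.

(** Reduces to the additive law by moving a negative summand to the other side:
    if x >= 0 > y then one of x and - y is a sum of two nonnegative elements,
    one of which is |x + y|. *)
Lemma levD_le x y : lev (x + y) <= Order.max (lev x) (lev y).
Proof.
wlog x0 : x y / 0 <= x.
  move=> W; case: (qleP 0 x) => x0; first exact: W.
  by rewrite -levN opprD -(levN _ x) -(levN _ y) W // opp_ge0E ltW.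
case: (qleP 0 y) => y0; first by rewrite levD.
case: (qleP 0 (x + y)) => s0.
  rewrite le_max; apply/orP; left; apply: le_lev => //.
  by rewrite -sub_ge0E opprD addrA subrr sub0r opp_ge0E ltW.
rewrite le_max; apply/orP; right; rewrite -levN -(levN _ y).
apply: le_lev; first by rewrite opp_ge0E ltW.
by rewrite -sub_ge0E opprK addrC addrK.
Qed.

Lemma levD_lt x y : lev x < lev y -> lev (x + y) = lev y.
Proof.
move=> xy; apply/le_anti/andP; split.
  by apply: le_trans (levD_le x y) _; rewrite ge_max lexx ltW.
have := levD_le (x + y) (- x); rewrite levN addrC addrA addNr add0r.
by rewrite le_max [X in _ || X]leNgt xy orbF.
Qed.

Lemma sub_split x p q : x - q = (x - p) + (p - q).
Proof. by rewrite addrA subrK. Qed.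

Lemma lev_tri_lt x p q : lev (x - p) < lev (p - q) -> lev (x - q) = lev (p - q).
Proof. by move=> h; rewrite (sub_split _ p) levD_lt. Qed.

Lemma lev_tri_gt x p q : lev (p - q) < lev (x - p) -> lev (x - q) = lev (x - p).
Proof. by move=> h; rewrite (sub_split x p q) (addrC (x - p)); apply: levD_lt. Qed.

Lemma lev_between x y z : x <= y -> y <= z ->
  lev (z - x) = Order.max (lev (y - x)) (lev (z - y)).
Proof. by move=> xy yz; rewrite (sub_split z y x) (addrC (z - y)) levD ?sub_ge0E. Qed.

Lemma suc_leE g h : (suc g <= h) = (g < h).
Proof. by apply/idP/idP => [|/suc_le //]; apply: lt_le_trans; apply: lt_suc. Qed.

Lemma suc_le2 g h : (suc g <= suc h) = (g <= h).
Proof.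
rewrite suc_leE; apply/idP/idP => [|gh]; last exact: le_lt_trans gh (lt_suc _ _).
by apply: contraLR; rewrite -ltNge -leNgt suc_leE.
Qed.

End LevelTheory.

(** * Counting the traces of cuts and translates of P *)

Lemma seq_minimum (T : eqType) (le : rel T) (s : seq T) (a : pred T) :
  total le -> transitive le -> has a s ->
  exists x, [/\ x \in s, a x & forall y, y \in s -> a y -> le x y].
Proof.
move=> le_tot le_tr; have lexx x : le x x by have := le_tot x x; rewrite orbb.
elim: s => //= x s IH; case: (boolP (has a s)) => [/IH[y [ys ay ymin]] _|/hasPn na].
  case: (boolP (a x && le x y)) => [/andP[ax xy]|nxy].
    exists x; split; rewrite ?mem_head // => z; rewrite inE => /predU1P[-> //|zs az].
    exact: le_tr xy (ymin z zs az).
  exists y; split; rewrite ?inE ?ys ?orbT // => z /predU1P[-> ax|]; last exact: ymin.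
  by move: nxy (le_tot x y); rewrite ax /= => /negbTE ->.
rewrite orbF => ax; exists x; split; rewrite ?mem_head // => z.
by rewrite inE => /predU1P[-> //|/na /negbTE ->].
Qed.

Section Counting.
Context (V : orderedQmodType) (P : V -> bool) (G : orderType ring_display).
Context (L : levels P G).
Implicit Types (x y z p : V) (D : V -> bool) (ps : seq V) (g h : G).
Local Notation lev := (lev L).

Definition downset D := forall x y, x <= y -> D y -> D x.

(** A ball is convex, hence a difference of two initial segments: everything up
    to its right end, and everything to the left of it. *)
Definition ball_cuts p (U : pred G) : seq (V -> bool) :=
  [:: fun x => (x <= p) || U (lev (x - p));
      fun x => (x <= p) && ~~ U (lev (x - p))].

Lemma ball_cuts_downset p (U : pred G) :
  (forall g h, g <= h -> U h -> U g) ->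
  forall D, D \in ball_cuts p U -> downset D.
Proof.
move=> Udown D; rewrite !inE => /orP[] /eqP-> x y xy.
  case: (qleP x p) => //= px; rewrite qleNgt (lt_le_trans px xy) /=.
  by apply: Udown; rewrite le_lev ?sub_ge0E ?leD2rE // ltW.
move=> /andP[yp nU]; rewrite (le_trans xy yp) /=.
apply: contra nU; apply: Udown; rewrite lev_subC (lev_subC _ x).
by rewrite le_lev ?sub_ge0E ?leB2lE.
Qed.

Definition agree_on (S : eqType) (b : S -> V -> bool) (s : seq S) x y :=
  forall i, i \in s -> b i x = b i y.

Local Notation same_cut := (agree_on (fun D => D)).
Local Notation same_color := (agree_on (fun p x => P (x - p))).

Lemma ball_cutsP p (U : pred G) x y :
  same_cut (ball_cuts p U) x y -> U (lev (x - p)) = U (lev (y - p)).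
Proof.
move=> xy.
have UE z : U (lev (z - p)) =
    ((z <= p) || U (lev (z - p))) && ~~ ((z <= p) && ~~ U (lev (z - p))).
  by case: (z <= p); case: (U _).
have e1 := xy (fun z => (z <= p) || U (lev (z - p))) (mem_head _ _).
have := xy (fun z => (z <= p) && ~~ U (lev (z - p))).
rewrite !inE eqxx orbT => /(_ isT) e2.
by rewrite [LHS]UE [RHS]UE e1 e2.
Qed.

(** The colour of x is its trace on the translates p + P, p in [ps].  Saying that
    among any three points of a class two have the same colour bounds the number
    of colours in a class by two without listing them. *)
Definition two_colors (Ds : seq (V -> bool)) ps :=
  forall x y z, same_cut Ds x y -> same_cut Ds x z ->
    [\/ same_color ps x y, same_color ps x z | same_color ps y z].

(** Each point p is added with the cuts of the two balls around it of radius
    rho = lev (p - q), open and closed, where q is a nearest old point.  Inside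
    the open ball the old colour is constant; on the sphere the level of x - p
    is rho; outside, x has the same level relative to p and to q.  In the last
    two regions the old colour decides the new one. *)
Lemma two_colors_cuts ps :
  exists Ds : seq (V -> bool),
    [/\ (size Ds <= 4 * size ps)%N, forall D, D \in Ds -> downset D
      & two_colors Ds ps].
Proof.
elim: ps => [|p ps [Ds [sD dD twoD]]].
  by exists [::]; split=> // x y z _ _; apply: Or31 => p.
case: ps => [|q0 ps0] in sD twoD *.
  exists [::]; split => // x y z _ _.
  have [e|[e|e]] : P (x - p) = P (y - p) \/
      (P (x - p) = P (z - p) \/ P (y - p) = P (z - p)).
  - by case: (P (x - p)) (P (y - p)) (P (z - p)) => [] [] []; tauto.
  - by apply: Or31 => r /[!inE] /eqP->.
  - by apply: Or32 => r /[!inE] /eqP->.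
  - by apply: Or33 => r /[!inE] /eqP->.
move: (q0 :: ps0) (isT : has predT (q0 :: ps0)) sD twoD => {q0 ps0} ps ps0 sD twoD.
have [q [qps _ qmin]] : exists q, [/\ q \in ps, true &
    forall r, r \in ps -> true -> lev (p - q) <= lev (p - r)].
  apply: (seq_minimum (le := fun q r => lev (p - q) <= lev (p - r))) ps0.
    by move=> q r; apply: le_total.
  by move=> ? ? ?; apply: le_trans.
set rho := lev (p - q).
exists (Ds ++ ball_cuts p (< rho) ++ ball_cuts p (<= rho)); split.
- by rewrite !size_cat /=; lia.
- move=> D; rewrite !mem_cat => /orP[/dD //|/orP[]].
    by apply: ball_cuts_downset => g h; apply: le_lt_trans.
  by apply: ball_cuts_downset => g h; apply: le_trans.
move=> x y z xy xz.
have split_cuts u w :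
    same_cut (Ds ++ ball_cuts p (< rho) ++ ball_cuts p (<= rho)) u w ->
    [/\ same_cut Ds u w, (lev (u - p) < rho) = (lev (w - p) < rho)
      & (lev (u - p) <= rho) = (lev (w - p) <= rho)].
  move=> uw; split.
  - by move=> D DD; apply: uw; rewrite mem_cat DD.
  - by apply: (@ball_cutsP p (< rho)) => D DD; apply: uw; rewrite !mem_cat DD !orbT.
  - by apply: (@ball_cutsP p (<= rho)) => D DD; apply: uw; rewrite !mem_cat DD !orbT.
have [cxy ltxy lexy] := split_cuts _ _ xy.
have [cxz ltxz lexz] := split_cuts _ _ xz.
case: (ltP (lev (x - p)) rho) => [xrho|xrho].
  (* Open ball: every old point r is at distance at least rho from p. *)
  have near w r : lev (w - p) < rho -> r \in ps -> P (w - r) = P (p - r).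
    move=> wrho rps; rewrite !(par_lev L); congr (par L _).
    by apply: lev_tri_lt; apply: lt_le_trans wrho (qmin r rps isT).
  have ext u w : lev (u - p) < rho -> lev (w - p) < rho ->
      P (u - p) = P (w - p) -> same_color (p :: ps) u w.
    move=> ur wr uw r; rewrite inE => /predU1P[->//|rps].
    by rewrite near // near.
  rewrite xrho in ltxy ltxz.
  have [e|[e|e]] : P (x - p) = P (y - p) \/
      (P (x - p) = P (z - p) \/ P (y - p) = P (z - p)).
  - by case: (P (x - p)) (P (y - p)) (P (z - p)) => [] [] []; tauto.
  - by apply: Or31; apply: ext.
  - by apply: Or32; apply: ext.
  - by apply: Or33; apply: ext.
(* Sphere and exterior: two points with equal old colours agree on p too. *)
have ext u w : rho <= lev (u - p) -> rho <= lev (w - p) ->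
    (lev (u - p) <= rho) = (lev (w - p) <= rho) ->
    same_color ps u w -> same_color (p :: ps) u w.
  move=> ur wr uw cuw r; rewrite inE => /predU1P[->|]; last exact: cuw.
  have := cuw q qps; rewrite !(par_lev L).
  case: (leP (lev (u - p)) rho) uw => [ule|ult] uw.
    rewrite (@le_anti _ _ (lev (u - p)) rho) ?ule //.
    by rewrite (@le_anti _ _ (lev (w - p)) rho) ?wr -?uw.
  have wlt : rho < lev (w - p) by rewrite ltNge -uw.
  by rewrite (@lev_tri_gt _ _ _ L u p q) // (@lev_tri_gt _ _ _ L w p q).
move: xrho; rewrite leNgt => xrho.
have yrho : ~~ (lev (y - p) < rho) by rewrite -ltxy.
have zrho : ~~ (lev (z - p) < rho) by rewrite -ltxz.
rewrite -!leNgt in xrho yrho zrho.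
case: (twoD x y z cxy cxz) => c.
- by apply: Or31; apply: ext.
- by apply: Or32; apply: ext.
- by apply: Or33; apply: ext; rewrite -?lexy.
Qed.

(** [R x y] is implied by agreement on cuts and translates of total cost K.  A
    translate costs four since [two_colors_cuts] trades it for four cuts. *)
Definition tame (K : nat) (R : V -> V -> Prop) :=
  exists (Ds : seq (V -> bool)) (ps : seq V),
    [/\ (size Ds + 4 * size ps <= K)%N, forall D, D \in Ds -> downset D
      & forall x y, same_cut Ds x y -> same_color ps x y -> R x y].

(** Initial segments form a chain under inclusion, so the number of those that
    contain x determines which ones do. *)
Lemma rank_inj (Ds : seq (V -> bool)) x y :
  (forall D, D \in Ds -> downset D) ->
  count (fun D => D x) Ds = count (fun D => D y) Ds -> same_cut Ds x y.
Proof.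
move=> dD; wlog xy : x y / x <= y.
  case: (qleP x y) => [xy|/ltW yx] W e; first exact: W.
  by move=> D DD; rewrite (W y x).
elim: Ds dD => [|D Ds IH] //= dD.
have le (D' : V -> bool) : D' \in D :: Ds -> (D' y <= D' x)%N.
  by move=> /dD/(_ x y xy); case: (D' y) => // ->.
have : (count (fun D => D y) Ds <= count (fun D => D x) Ds)%N.
  elim: Ds {IH dD} le => //= D' Ds IH le.
  apply: leq_add; first by apply: le; rewrite !inE eqxx orbT.
  apply: IH => D2 D2D; apply: le; move: D2D; rewrite !inE.
  by case/orP=> ->; rewrite ?orbT.
have := le D (mem_head _ _) => leD leC e.
have eD : D x = D y by move: leD leC e; case: (D x); case: (D y) => //=; lia.
move=> D' /[!inE] /predU1P[->//|]; apply: IH; last by lia.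
by move=> D2 D2D; apply: dD; rewrite inE D2D orbT.
Qed.

(** At most K cuts leave K + 1 classes, and each class has at most two colours:
    the number of classes is linear in K, where independent conditions would
    give an exponential number. *)
Lemma tame_card K R : tame K R ->
  forall (I : finType) (c : I -> V), (forall i j, i != j -> ~ R (c i) (c j)) ->
  (#|I| <= 2 * K.+1)%N.
Proof.
move=> [Ds1 [ps [sK dD1 RD]]] I c cR.
have [Ds2 [sD2 dD2 two]] := two_colors_cuts ps.
pose Ds := Ds1 ++ Ds2.
have dD D : D \in Ds -> downset D by rewrite mem_cat => /orP[/dD1|/dD2].
have sD : (size Ds <= K)%N by rewrite size_cat; lia.
have rankP x : (count (fun D => D x) Ds < K.+1)%N.
  by rewrite ltnS (leq_trans (count_size _ _)).
pose rank i : 'I_K.+1 := Ordinal (rankP (c i)).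
have fiber k : (#|[set i | rank i == k]| <= 2)%N.
  rewrite leqNgt; apply/negP => /card_gt2P[i [j [l [[]]]]].
  rewrite !inE => /eqP ri /eqP rj /eqP rl [ij jl li].
  have cut u w : rank u = rank w -> same_cut Ds (c u) (c w).
    by move=> [e]; apply: rank_inj.
  have cut1 u w : rank u = rank w -> same_cut Ds1 (c u) (c w).
    by move=> /cut e D DD; apply: e; rewrite mem_cat DD.
  have cut2 u w : rank u = rank w -> same_cut Ds2 (c u) (c w).
    by move=> /cut e D DD; apply: e; rewrite mem_cat DD orbT.
  case: (two (c i) (c j) (c l)); rewrite ?ri ?rj ?rl.
  - by apply: cut2; rewrite ri.
  - by apply: cut2; rewrite ri.
  - by move=> e; apply: (cR i j ij); apply: RD => //; apply: cut1; rewrite ri.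
  - move=> e; apply: (cR i l); rewrite 1?eq_sym //.
    by apply: RD => //; apply: cut1; rewrite ri.
  - by move=> e; apply: (cR j l jl); apply: RD => //; apply: cut1; rewrite rj.
rewrite -sum1_card (partition_big rank xpredT) //=.
apply: (@leq_trans (\sum_(k < K.+1) 2)); last by rewrite sum_nat_const card_ord mulnC.
apply: leq_sum => k _; rewrite sum1_card; apply: leq_trans (fiber k).
by apply: eq_leq; apply: eq_card => i; rewrite !inE.
Qed.

Lemma tame_sub K K' R R' : (K <= K')%N -> (forall x y, R x y -> R' x y) ->
  tame K R -> tame K' R'.
Proof.
move=> KK RR [Ds [ps [sK dD RD]]]; exists Ds, ps; split => //.
  exact: leq_trans KK.
by move=> x y xy1 xy2; apply/RR/RD.
Qed.

Lemma tame_and K1 K2 R1 R2 : tame K1 R1 -> tame K2 R2 ->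
  tame (K1 + K2) (fun x y => R1 x y /\ R2 x y).
Proof.
move=> [Ds1 [ps1 [sK1 dD1 RD1]]] [Ds2 [ps2 [sK2 dD2 RD2]]].
exists (Ds1 ++ Ds2), (ps1 ++ ps2); split.
- by rewrite !size_cat; lia.
- by move=> D; rewrite mem_cat => /orP[/dD1|/dD2].
move=> x y xy1 xy2; split.
  by apply: RD1 => i ii; [apply: xy1|apply: xy2]; rewrite mem_cat ii.
by apply: RD2 => i ii; [apply: xy1|apply: xy2]; rewrite mem_cat ii orbT.
Qed.

Lemma tame_all (S : eqType) K (s : seq S) (R : S -> V -> V -> Prop) :
  (forall i, i \in s -> tame K (R i)) ->
  tame (size s * K) (fun x y => forall i, i \in s -> R i x y).
Proof.
elim: s => [|i s IH] tR; first by exists [::], [::]; split.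
rewrite /= mulSn; have ti := tR i (mem_head _ _).
apply: tame_sub (tame_and ti (IH _)) => //; last first.
  by move=> j js; apply: tR; rewrite inE js orbT.
by move=> x y [Ri Rs] j; rewrite inE => /predU1P[->|/Rs].
Qed.

Lemma tame_downset D : downset D -> tame 1 (fun x y => D x = D y).
Proof.
move=> dD; exists [:: D], [::]; split => //; first by move=> ? /[!inE] /eqP->.
by move=> x y /(_ D (mem_head _ _)).
Qed.

Lemma tame_ball p (U : pred G) : (forall g h, g <= h -> U h -> U g) ->
  tame 2 (fun x y => U (lev (x - p)) = U (lev (y - p))).
Proof.
move=> Udown; exists (ball_cuts p U), [::]; split => //.
  exact: ball_cuts_downset.
by move=> x y xy _; apply: ball_cutsP xy.
Qed.

Lemma tame_color p : tame 4 (fun x y => P (x - p) = P (y - p)).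
Proof. by exists [::], [:: p]; split => // x y _ /(_ p (mem_head _ _)). Qed.

End Counting.

(** * Back and forth in the chain of levels *)

Section Chain.
Context (V : orderedQmodType) (P : V -> bool) (G : orderType ring_display).
Context (L : levels P G).
Implicit Types (g h a b : G) (E : seq (G * G)) (e f : G * G) (D n m : nat).
Local Notation lev := (lev L).
Local Notation suc := (suc L).
Local Notation par := (par L).

Lemma iter_suc_le2 n g h : (iter n suc g <= iter n suc h) = (g <= h).
Proof. by elim: n => //= n; rewrite (suc_le2 L). Qed.

Lemma le_iter_suc n g : g <= iter n suc g.
Proof. by elim: n => //= n IH; apply: le_trans IH (ltW (lt_suc _ _)). Qed.

Lemma iter_suc_mono n m g : (n <= m)%N -> iter n suc g <= iter m suc g.
Proof. by move=> nm; rewrite -(subnKC nm) iterD iter_suc_le2 le_iter_suc. Qed.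

Lemma iter_suc_le_self n g : (iter n suc g <= g) = (n == 0%N).
Proof.
case: n => [|n]; first by rewrite lexx.
by rewrite iterS (suc_leE L) ltNge le_iter_suc.
Qed.

Lemma iter_suc_ltE n g h : (iter n.+1 suc g <= h) = (iter n suc g < h).
Proof. by rewrite iterS (suc_leE L). Qed.

Lemma iter_suc_far D g a :
  (forall n, (n <= D)%N -> a != iter n suc g) -> g <= a -> iter D.+1 suc g <= a.
Proof.
move=> ne ga; elim: D ne => [|D IH] ne; rewrite iter_suc_ltE lt_neqAle eq_sym ne //.
by rewrite IH // => n nD; apply: ne; apply: leqW.
Qed.

Lemma iter_suc_onto n g : iter n suc (lev 0) <= g -> exists h, g = iter n suc h.
Proof.
elim: n g => [|n IH] g; first by exists g.
rewrite iterS (suc_leE L) => lt0; have [|h gE] := @suc_onto _ _ _ L g.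
  exact: le_lt_trans (le_iter_suc _ _) lt0.
move: lt0; rewrite gE -(suc_leE L) (suc_le2 L) => /IH[k ->].
by exists k.
Qed.

(** E is read as a finite partial map.  It is similar at depth D when it preserves
    parities and all distances, the distances above D not being told apart. *)
Definition similar D E :=
  (forall e, e \in E -> par e.1 = par e.2) /\
  forall e f n, e \in E -> f \in E -> (n <= D)%N ->
    (iter n suc e.1 <= f.1) = (iter n suc e.2 <= f.2).

Lemma similar_sub D D' E E' :
  (D' <= D)%N -> {subset E' <= E} -> similar D E -> similar D' E'.
Proof.
move=> DD EE [sp sl]; split=> [e /EE|e f n /EE eE /EE fE nD]; first exact: sp.
by apply: sl; rewrite // (leq_trans nD).
Qed.

Lemma similar_iter D E e f n m : similar D E -> e \in E -> f \in E ->
  (n <= D)%N -> (m < D)%N ->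
  (iter n suc e.1 <= iter m suc f.1) = (iter n suc e.2 <= iter m suc f.2).
Proof.
move=> [_ sl] eE fE nD mD; case: (leqP m n) => mn.
  rewrite -(subnKC mn) !iterD !iter_suc_le2; apply: sl => //; lia.
rewrite -(subnKC (ltnW mn)) !iterD !iter_suc_le2 !leNgt -!iter_suc_ltE.
by congr negb; apply: sl => //; lia.
Qed.

Lemma similar_cons D E a b : similar D E -> par a = par b ->
  (forall e n, e \in E -> (n <= D)%N ->
    (iter n suc e.1 <= a) = (iter n suc e.2 <= b) /\
    (iter n suc a <= e.1) = (iter n suc b <= e.2)) ->
  similar D ((a, b) :: E).
Proof.
move=> [sp sl] pab ab; split=> [e|e f n].
  by rewrite inE => /predU1P[-> //|/sp].
rewrite !inE => /predU1P[->|eE] /predU1P[->|fE] nD /=.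
- by rewrite !iter_suc_le_self.
- by case: (ab f n fE nD).
- by case: (ab e n eE nD).
- exact: sl.
Qed.

Lemma par_iter n g : par (iter n suc g) = odd n (+) par g.
Proof. by elim: n => //= n IH; rewrite par_suc IH addNb. Qed.

(** A level within D of the domain of E is answered by the level at the same
    distance from the image.  Any other level a is more than D above the nearest
    domain element g below it and more than D below every larger one; there the
    image of g moved up by D + 1 or D + 2 steps, whichever has the right parity,
    is far from everything.  The gap above g is at least 2 D + 3 in the second
    case, which is where the depth of the hypothesis comes from. *)
Lemma similar_extend D E a : similar (2 * D + 3) E -> (lev 0, lev 0) \in E ->
  exists b, similar D ((a, b) :: E).
Proof.
move=> sE bE; have sDE : similar D E by apply: similar_sub sE => //; lia.
have near_or_far : (exists e n, [/\ e \in E, (n <= D)%N & a = iter n suc e.1]) \/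
    (forall e n, e \in E -> (n <= D)%N -> a != iter n suc e.1).
  case: (pselect (exists e n, [/\ e \in E, (n <= D)%N & a = iter n suc e.1])).
    by left.
  by move=> no; right=> e n eE nD; apply/eqP => ae; apply: no; exists e, n.
case: near_or_far => [[g [m [gE mD aE]]]|far_above].
  exists (iter m suc g.2); apply: similar_cons => //.
    by rewrite aE !par_iter (sE.1 g gE).
  move=> e n eE nD; rewrite aE -!iterD; split.
    by apply: similar_iter sE _ _ _ _ => //; lia.
  by apply: sE.2 => //; lia.
have near_or_far : (exists e n, [/\ e \in E, (n <= D)%N & e.1 = iter n suc a]) \/
    (forall e n, e \in E -> (n <= D)%N -> e.1 != iter n suc a).
  case: (pselect (exists e n, [/\ e \in E, (n <= D)%N & e.1 = iter n suc a])).
    by left.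
  by move=> no; right=> e n eE nD; apply/eqP => ae; apply: no; exists e, n.
case: near_or_far => [[g [m [gE mD gaE]]]|far_below].
  have [b gbE] : exists b, g.2 = iter m suc b.
    apply: iter_suc_onto; rewrite -(sE.2 (lev 0, lev 0) g m) //=; last by lia.
    by rewrite gaE iter_suc_le2 bot_le.
  exists b; apply: similar_cons => //.
    have := sE.1 g gE; rewrite gaE gbE !par_iter.
    exact: addbI.
  move=> e n eE nD; split.
    rewrite -(iter_suc_le2 m) -(iter_suc_le2 m _ b) -gaE -gbE -!iterD.
    by apply: sE.2 => //; lia.
  rewrite -(iter_suc_le2 m) -(iter_suc_le2 m _ e.2) -!iterD addnC !iterD -gaE -gbE.
  by apply: similar_iter sE _ _ _ _ => //; lia.
(* The level [lev 0] is in the domain, so some domain element is below a. *)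
have [g [gE ga gmax]] : exists g : G * G, [/\ g \in E, g.1 <= a &
    forall e, e \in E -> e.1 <= a -> e.1 <= g.1].
  apply: (seq_minimum (le := fun f e => e.1 <= f.1) (a := fun e => e.1 <= a)).
  - by move=> e f; apply: le_total.
  - by move=> e f h /= fe hf; apply: le_trans hf fe.
  - by apply/hasP; exists (lev 0, lev 0) => //=; apply: bot_le.
have [m [m1 m2 ma pm]] : exists m, [/\ (D < m)%N, (m <= D + 2)%N,
    iter m suc g.1 <= a & par (iter m suc g.1) = par a].
  have le1 := iter_suc_far (fun n => far_above g n gE) ga.
  have := par_iter D.+1 g.1; have := par_iter D.+2 g.1; move=> p2 p1.
  case: (par (iter D.+1 suc g.1) =P par a) => [pa|npa].
    by exists D.+1; split=> //; rewrite ?addn2.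
  exists D.+2; split=> //; rewrite ?addn2 //.
    rewrite iter_suc_ltE lt_neqAle le1 andbT; apply/eqP => e; apply: npa.
    by rewrite e.
  rewrite p2 /= negbK; move: npa; rewrite p1 /=.
  by case: (odd D); case: (par g.1); case: (par a).
exists (iter m suc g.2); apply: similar_cons => //.
  by rewrite -pm !par_iter (sE.1 g gE).
move=> e n eE nD; case: (leP e.1 a) => ea.
  have eg := gmax e eE ea.
  have eg2 : e.2 <= g.2 by rewrite -[e.2]/(iter 0 suc e.2) -(sE.2 e g 0).
  have le1 := iter_suc_far (fun n => far_above e n eE) ea.
  split.
    transitivity true; last symmetry.
      by apply: le_trans le1; apply: iter_suc_mono; apply: leqW.
    apply: (@le_trans _ _ (iter n suc g.2)); first by rewrite iter_suc_le2.
    by apply: iter_suc_mono; apply: leq_trans nD (ltnW m1).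
  transitivity false; last symmetry.
    apply/negbTE; rewrite -ltNge; apply: lt_le_trans (le_iter_suc n a).
    by rewrite -(suc_leE L); apply: le_trans le1; apply: (@iter_suc_mono 1).
  apply/negbTE; rewrite -ltNge -iterD; apply: (le_lt_trans eg2).
  by rewrite ltNge iter_suc_le_self; lia.
have le1 : iter D.+1 suc a <= e.1.
  by apply: iter_suc_far (ltW ea) => k kD; apply: far_below.
have le2 : iter (D.+1 + m) suc g.2 <= e.2.
  rewrite -(sE.2 g e) //; last by lia.
  by rewrite iterD (le_trans _ le1) // iter_suc_le2.
split.
  transitivity false; last symmetry.
    by apply/negbTE; rewrite -ltNge; apply: lt_le_trans ea (le_iter_suc _ _).
  apply/negbTE; rewrite -ltNge; apply: lt_le_trans (le_iter_suc _ _).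
  rewrite -(suc_leE L) -iterS; apply: le_trans le2.
  by apply: iter_suc_mono; rewrite addSn ltnS leq_addl.
transitivity true; last symmetry.
  by apply: le_trans le1; apply: iter_suc_mono; apply: leqW.
by apply: le_trans le2; rewrite -iterD; apply: iter_suc_mono; rewrite leq_add2r leqW.
Qed.

End Chain.

(** * Back and forth with one point *)

Section OnePoint.
Context (V : orderedQmodType) (P : V -> bool) (G : orderType ring_display).
Context (L : levels P G).
Implicit Types (c d : V) (a l r : V * V) (pts : seq (V * V)) (E : seq (G * G)).
Local Notation lev := (lev L).
Local Notation similar := (similar L).

(** Levels relative to a far point are maxima of levels relative to the neighbour
    of c and levels of differences of old points; a similar relation is closed
    under such maxima. *)
Lemma similar_max D E e f : similar D E -> e \in E -> f \in E ->
  (Order.max e.1 f.1, Order.max e.2 f.2) \in E.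
Proof.
move=> [_ sl] eE fE; rewrite !maxEle; have /= -> := sl e f 0%N eE fE (leq0n _).
by case: ifP; rewrite -surjective_pairing.
Qed.

(** [pts] pairs the old points with their images, and E pairs levels.  Only order
    and the levels of differences matter for answering a new point. *)
Definition aligned pts E :=
  {in pts &, forall a b, (a.1 < b.1) = (a.2 < b.2)} /\
  {in pts &, forall a b, (lev (a.1 - b.1), lev (a.2 - b.2)) \in E}.

Definition matched D pts E c d :=
  (forall a, a \in pts ->
     (a.1 < c) = (a.2 < d) /\ (c < a.1) = (d < a.2)) /\
  similar D (E ++ [seq (lev (c - a.1), lev (d - a.2)) | a <- pts]).

Lemma matched_intro D pts E E' c d :
  {subset E <= E'} -> similar D E' ->
  (forall a, a \in pts -> [/\ (a.1 < c) = (a.2 < d), (c < a.1) = (d < a.2)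
     & (lev (c - a.1), lev (d - a.2)) \in E']) ->
  matched D pts E c d.
Proof.
move=> EE sE' cd; split=> [a /cd[]//|].
apply: similar_sub sE' => // e; rewrite mem_cat => /orP[/EE //|].
by case/mapP=> a /cd[_ _ h] ->.
Qed.

Lemma aligned_le pts E a b : aligned pts E -> a \in pts -> b \in pts ->
  (a.1 <= b.1) = (a.2 <= b.2).
Proof. by move=> [o _] apts bpts; rewrite !qleNgt o. Qed.

(** Here c lies just to the right of the old point l, nearer to l than all the
    points on its right are.  Then lev (c - l) determines all the other levels,
    and any positive displacement of the matching level from the image of l
    lands in the right gap: it is too small to reach the next point. *)
Lemma match_left D pts E c l :
  aligned pts E -> similar (2 * D + 3) E -> (lev 0, lev 0) \in E ->
  l \in pts -> l.1 < c ->
  (forall a, a \in pts -> c != a.1) ->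
  (forall a, a \in pts -> a.1 < c -> a.1 <= l.1) ->
  (forall a, a \in pts -> c < a.1 -> lev (c - l.1) < lev (a.1 - l.1)) ->
  exists d, matched D pts E c d.
Proof.
move=> al sE bE lpts lc ne lmax far.
have [b sb] := similar_extend (lev (c - l.1)) sE bE.
have [x x0 xb] := lev_onto L b.
have dl : l.2 + x - l.2 = x by rewrite addrC addKr.
have ld : l.2 < l.2 + x by rewrite -sub_gt0E dl.
have inE' e : e \in E -> e \in (lev (c - l.1), b) :: E by rewrite inE orbC => ->.
exists (l.2 + x); apply: (matched_intro inE' sb) => a apts.
have aE : (lev (l.1 - a.1), lev (l.2 - a.2)) \in E by apply: al.2.
case: (qltgtP a.1 c) (ne a apts) => [ac _|ca _|-> /eqP//].
  have al1 := lmax a apts ac; have al2 := al1; rewrite (aligned_le al) // in al2.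
  have ad := le_lt_trans al2 ld.
  split; rewrite ?ad //; first by rewrite qltNge (ltW ad).
  rewrite (lev_between L al1 (ltW lc)) (lev_between L al2 (ltW ld)) dl xb.
  exact: (similar_max sb (inE' _ aE) (mem_head _ _)).
have lt1 : lev (c - l.1) < lev (l.1 - a.1) by rewrite (lev_subC _ l.1) far.
have lt2 : lev (l.2 + x - l.2) < lev (l.2 - a.2).
  rewrite dl xb ltNge; move: lt1; rewrite ltNge; apply: contra.
  by have /= -> := sb.2 _ _ 0%N (inE' _ aE) (mem_head _ _) (leq0n _).
have da : l.2 + x < a.2.
  rewrite qltNge; apply/negP => ad.
  have la : l.2 <= a.2 by rewrite -(aligned_le al) // ltW // (lt_trans lc).
  move: lt2; rewrite lev_subC (lev_subC _ l.2) ltNge => /negP; apply.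
  by rewrite (lev_subC _ l.2) le_lev ?sub_ge0E ?leD2rE.
split; rewrite ?da //; first by rewrite qltNge (ltW da).
by rewrite (lev_tri_lt lt1) (lev_tri_lt lt2) inE' //.
Qed.

(** The reflection x |-> - x exchanges left and right neighbours. *)
Definition opp_pts pts := [seq (- a.1, - a.2) | a <- pts].

Lemma lev_opp x y : lev (- x - - y) = lev (x - y).
Proof. by rewrite -opprD levN. Qed.

Lemma aligned_opp pts E : aligned pts E -> aligned (opp_pts pts) E.
Proof.
move=> [o le]; split=> _ _ /mapP[a apts ->] /mapP[b bpts ->] /=.
  by rewrite !ltN2E o.
by rewrite !lev_opp le.
Qed.

Lemma matched_opp D pts E c d :
  matched D (opp_pts pts) E (- c) (- d) -> matched D pts E c d.
Proof.
move=> [o s]; split.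
  move=> a apts; have := o (- a.1, - a.2) (map_f _ apts).
  by rewrite /= !ltN2E => -[].
move: s; rewrite -map_comp (eq_map (g := fun a => (lev (c - a.1), lev (d - a.2)))) //.
by move=> a /=; rewrite !lev_opp.
Qed.

Lemma match_right D pts E c r :
  aligned pts E -> similar (2 * D + 3) E -> (lev 0, lev 0) \in E ->
  r \in pts -> c < r.1 ->
  (forall a, a \in pts -> c != a.1) ->
  (forall a, a \in pts -> c < a.1 -> r.1 <= a.1) ->
  (forall a, a \in pts -> a.1 < c -> lev (r.1 - c) < lev (r.1 - a.1)) ->
  exists d, matched D pts E c d.
Proof.
move=> al sE bE rpts cr ne rmin far.
have [|||||d dm] := @match_left D (opp_pts pts) E (- c) (- r.1, - r.2)
    (aligned_opp al) sE bE; rewrite /= ?ltN2E //.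
- exact: map_f.
- by move=> _ /mapP[a apts ->]; rewrite /= eqr_opp ne.
- move=> _ /mapP[a apts ->] /=; rewrite ltN2E => ca.
  by rewrite qleNgt ltN2E -qleNgt rmin.
- move=> _ /mapP[a apts ->] /=; rewrite ltN2E => ac.
  by rewrite !lev_opp lev_subC (lev_subC _ a.1) far.
by exists (- d); apply: matched_opp; rewrite opprK.
Qed.

(** When c is as far from both neighbours as these are from each other, all the
    levels relative to c are those of differences of old points, and the midpoint
    of the images has the same property. *)
Lemma match_middle D pts E c l r :
  aligned pts E -> similar D E -> l \in pts -> r \in pts ->
  l.1 < c -> c < r.1 ->
  (forall a, a \in pts -> c != a.1) ->
  (forall a, a \in pts -> a.1 < c -> a.1 <= l.1) ->
  (forall a, a \in pts -> c < a.1 -> r.1 <= a.1) ->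
  lev (c - l.1) = lev (r.1 - l.1) -> lev (r.1 - c) = lev (r.1 - l.1) ->
  matched D pts E c (2^-1 *: (l.2 + r.2)).
Proof.
move=> al sE lpts rpts lc cr ne lmax rmin ldist rdist.
have half_gt0 : 0 < 2^-1 :> rat by [].
have lr : l.2 < r.2 by rewrite -al.1 // (lt_trans lc).
have dlE : 2^-1 *: (l.2 + r.2) - l.2 = 2^-1 *: (r.2 - l.2) by rewrite sub_mid.
have rdE : r.2 - 2^-1 *: (l.2 + r.2) = 2^-1 *: (r.2 - l.2).
  by rewrite -opprB (addrC l.2) sub_mid -scalerN opprB.
have ld : l.2 < 2^-1 *: (l.2 + r.2).
  by rewrite -sub_gt0E dlE scale_gt0E // sub_gt0E.
have dr : 2^-1 *: (l.2 + r.2) < r.2.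
  by rewrite -sub_gt0E rdE scale_gt0E // sub_gt0E.
apply: (matched_intro (E' := E)) => // a apts.
have rlE : (lev (r.1 - l.1), lev (r.2 - l.2)) \in E by apply: al.2.
case: (qltgtP a.1 c) (ne a apts) => [ac _|ca _|-> /eqP//].
  have al1 := lmax a apts ac; have al2 := al1; rewrite (aligned_le al) // in al2.
  have ad := le_lt_trans al2 ld.
  split; rewrite ?ad //; first by rewrite qltNge (ltW ad).
  rewrite (lev_between L al1 (ltW lc)) (lev_between L al2 (ltW ld)) dlE levZ_pos //.
  by rewrite ldist; apply: (similar_max sE (al.2 l a lpts apts) rlE).
have ra1 := rmin a apts ca; have ra2 := ra1; rewrite (aligned_le al) // in ra2.
have da := lt_le_trans dr ra2.
split; rewrite ?da //; first by rewrite qltNge (ltW da).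
rewrite lev_subC (lev_subC _ _ a.2).
rewrite (lev_between L (ltW cr) ra1) (lev_between L (ltW dr) ra2) rdE levZ_pos //.
by rewrite rdist; apply: (similar_max sE rlE (al.2 a r apts rpts)).
Qed.

(** Let l and r be the neighbours of c.  The larger of lev (c - l) and lev (r - c)
    is lev (r - l), so either one of the two is smaller, which is the one-sided
    situation, or both are equal to it, which is the middle one. *)
Lemma match_point D pts E c :
  aligned pts E -> similar (2 * D + 3) E -> (lev 0, lev 0) \in E ->
  exists d, matched D pts E c d.
Proof.
move=> al sE bE; have sDE : similar D E by apply: similar_sub sE => //; lia.
case: (boolP (has (fun a => c == a.1) pts)) => [/hasP[a apts /eqP ->]|/hasPn ne].
  exists a.2; apply: (matched_intro _ sDE) => // b bpts.
  by split; [exact: al.1|exact: al.1|exact: al.2].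
have leftP : (exists l, [/\ l \in pts, l.1 < c &
      forall a, a \in pts -> a.1 < c -> a.1 <= l.1]) \/
    (forall a, a \in pts -> ~~ (a.1 < c)).
  case: (boolP (has (fun a => a.1 < c) pts)) => [hl|/hasPn]; last by right.
  left; apply: (seq_minimum (le := fun a b => b.1 <= a.1)) hl => [a b|a b e /= ab be].
    by rewrite orbC; apply: comparable_all.
  exact: le_trans be ab.
have rightP : (exists r, [/\ r \in pts, c < r.1 &
      forall a, a \in pts -> c < a.1 -> r.1 <= a.1]) \/
    (forall a, a \in pts -> ~~ (c < a.1)).
  case: (boolP (has (fun a => c < a.1) pts)) => [hr|/hasPn]; last by right.
  left; apply: (seq_minimum (le := fun a b => a.1 <= b.1)) hr => [a b|a b e /= ab be].
    exact: comparable_all.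
  exact: le_trans ab be.
case: leftP => [[l [lpts lc lmax]]|nol]; case: rightP => [[r [rpts cr rmin]]|nor].
- have rl a : a \in pts -> c < a.1 -> lev (r.1 - l.1) <= lev (a.1 - l.1).
    move=> apts ca; apply: le_lev; last by rewrite leD2rE rmin.
    by rewrite sub_ge0E ltW // (lt_trans lc).
  have lr a : a \in pts -> a.1 < c -> lev (r.1 - l.1) <= lev (r.1 - a.1).
    move=> apts ac; apply: le_lev; last by rewrite leB2lE lmax.
    by rewrite sub_ge0E ltW // (lt_trans lc).
  have := lev_between L (ltW lc) (ltW cr).
  case: (ltP (lev (c - l.1)) (lev (r.1 - l.1))) => [llt _|lge].
    apply: match_left lpts lc ne lmax _ => // a apts ca.
    exact: lt_le_trans llt (rl a apts ca).
  case: (ltP (lev (r.1 - c)) (lev (r.1 - l.1))) => [rlt _|rge lrE].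
    apply: match_right rpts cr ne rmin _ => // a apts ac.
    exact: lt_le_trans rlt (lr a apts ac).
  exists (2^-1 *: (l.2 + r.2)); apply: match_middle => //.
    by apply/le_anti; rewrite lge andbT lrE le_max lexx.
  by apply/le_anti; rewrite rge andbT lrE le_max lexx orbT.
- apply: match_left lpts lc ne lmax _ => // a apts ca.
  by have := nor a apts; rewrite ca.
- apply: match_right rpts cr ne rmin _ => // a apts ac.
  by have := nol a apts; rewrite ac.
- exists c; apply: (matched_intro _ sDE) => // a apts.
  have := ne a apts; case: (qltgtP a.1 c) => [ac|ca|-> /eqP//].
    by have := nol a apts; rewrite ac.
  by have := nor a apts; rewrite ca.
Qed.
End OnePoint.

(** * Finitely determined relations *)

HB.instance Definition _ := gen_eqMixin term.

Fixpoint coef (i : nat) (t : term) : rat :=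
  match t with
  | Var j => (j == i)%:R
  | Zero => 0
  | Plus s t => coef i s + coef i t
  | Scal q t => q * coef i t
  end.

Fixpoint tsubst (sigma : nat -> term) (t : term) : term :=
  match t with
  | Var j => sigma j
  | Zero => Zero
  | Plus s t => Plus (tsubst sigma s) (tsubst sigma t)
  | Scal q t => Scal q (tsubst sigma t)
  end.

Definition rest_term (i : nat) : term -> term := tsubst (update Var i Zero).
(** If t depends on x_i, the value of x_i at which t vanishes, as a term in the other
    variables. *)
Definition root_term (i : nat) (t : term) : term :=
  Scal (- (coef i t)^-1) (rest_term i t).
Definition Minus (s t : term) : term := Plus s (Scal (-1) t).

Section Finitary.
Context (V : orderedQmodType) (P : V -> bool) (G : orderType ring_display).
Context (L : levels P G).
Implicit Types (v w u : nat -> V) (i : nat) (s t f : term) (F : seq term) (c d x y : V).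
Implicit Types (X Y : (nat -> V) -> Prop).
Local Notation lev := (lev L).
Local Notation suc := (suc L).
Local Notation par := (par L).
Local Notation similar := (similar L).

Fixpoint lin v t : V :=
  match t with
  | Var j => v j
  | Zero => 0
  | Plus s t => lin v s + lin v t
  | Scal q t => q *: lin v t
  end.

Lemma lin_tsubst (sigma : nat -> term) v t :
  lin v (tsubst sigma t) = lin (fun j => lin v (sigma j)) t.
Proof. by elim: t => //= [s -> t ->|q t ->]. Qed.

Lemma lin_update v i c t :
  lin (update v i c) t = coef i t *: c + lin v (rest_term i t).
Proof.
elim: t => [j||s IHs t IHt|q t IH] /=.
- rewrite /rest_term /= /update.
  by case: eqP => _ /=; rewrite ?scale1r ?addr0 ?scale0r ?add0r.
- by rewrite scale0r addr0.
- by rewrite IHs IHt scalerDl addrACA.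
- by rewrite IH scalerDr scalerA.
Qed.

Lemma lin_Minus v s t : lin v (Minus s t) = lin v s - lin v t.
Proof. by rewrite /= scaleN1r. Qed.

Lemma lin_update_const v i c t : coef i t = 0 ->
  lin (update v i c) t = lin v (rest_term i t).
Proof. by move=> t0; rewrite lin_update t0 scale0r add0r. Qed.

Lemma lin_update_root v i c t : coef i t != 0 ->
  lin (update v i c) t = coef i t *: (c - lin v (root_term i t)).
Proof.
by move=> t0; rewrite lin_update scalerBr /= scalerA mulrN divff // scaleN1r opprK.
Qed.

Definition levs F v w := [seq (lev (lin v f), lev (lin w f)) | f <- F].

(** The two assignments have the same quantifier-free type, as far as it is seen by
    the terms of F and by distances of levels up to D. *)
Definition agree D F v w :=
  (forall f, f \in F -> (0 < lin v f) = (0 < lin w f) /\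
                        (lin v f < 0) = (lin w f < 0)) /\
  similar D (levs F v w).

Lemma levsP F v w f : f \in F -> (lev (lin v f), lev (lin w f)) \in levs F v w.
Proof. exact: map_f. Qed.

Lemma agree_sub D D' F F' v w :
  (D' <= D)%N -> {subset F' <= F} -> agree D F v w -> agree D' F' v w.
Proof.
move=> DD FF [sg sm]; split=> [f /FF|]; first exact: sg.
apply: similar_sub sm => // e /mapP[f /FF fF ->]; exact: levsP.
Qed.

Lemma agree_sym D F v w : agree D F v w -> agree D F w v.
Proof.
move=> [sg [sp sl]]; split=> [f /sg[-> ->] //|]; split.
  by move=> e /mapP[f fF ->] /=; symmetry; apply: (sp (_, _)); apply: levsP.
move=> e e' n /mapP[f fF ->] /mapP[g gF ->] nD /=; symmetry.
by apply: (sl (_, _) (_, _)) => //; apply: levsP.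
Qed.

Definition root_terms i F := [seq root_term i f | f <- F & coef i f != 0].

(** Zero is included so that the first level corresponds to the first level, as
    [similar_extend] requires. *)
Definition step_terms i F :=
  Zero :: [seq rest_term i f | f <- F] ++
  [seq Minus s t | s <- root_terms i F, t <- root_terms i F].

(** After dividing by coefficients, every term of F containing x_i is the difference
    between x_i and its root, so the new value of x_i has to be placed with respect
    to finitely many points, which is [match_point]. *)
Lemma agree_step D F i v w c : agree (2 * D + 3) (step_terms i F) v w ->
  exists d, agree D F (update v i c) (update w i d).
Proof.
set F' := step_terms i F => -[sg sm].
have rest_in f : f \in F -> rest_term i f \in F'.
  by move=> fF; rewrite inE mem_cat map_f ?orbT.
have sub_in s t : s \in root_terms i F -> t \in root_terms i F -> Minus s t \in F'.
  by move=> sF tF; rewrite inE mem_cat allpairs_f ?orbT.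
pose pts := [seq (lin v s, lin w s) | s <- root_terms i F].
have al : aligned L pts (levs F' v w).
  split=> _ _ /mapP[s sF ->] /mapP[t tF ->] /=.
    have [+ _] := sg _ (sub_in _ _ tF sF).
    by rewrite !lin_Minus !sub_gt0E.
  by have := levsP v w (sub_in _ _ sF tF); rewrite !lin_Minus.
have zero_in : (lev 0, lev 0) \in levs F' v w.
  by apply: (@levsP F' v w Zero); rewrite mem_head.
have [d [dpts dsim]] := match_point c al sm zero_in.
exists d.
have rootP f : f \in F -> coef i f != 0 ->
    (lin v (root_term i f), lin w (root_term i f)) \in pts.
  by move=> fF f0; apply: map_f; apply: map_f; rewrite mem_filter f0.
split.
  move=> f fF; case: (altP (coef i f =P 0)) => f0.
    by rewrite !lin_update_const //; apply: sg; apply: rest_in.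
  rewrite !lin_update_root //; have [/= lt1 lt2] := dpts _ (rootP f fF f0).
  move: f0; case: (ltgtP (coef i f) 0) => // cf _; last first.
    by rewrite !scale_gt0E // !scale_lt0E // !sub_gt0E !sub_lt0E.
  by rewrite !scale_neg_gt0E // !scale_neg_lt0E // !sub_gt0E !sub_lt0E.
apply: similar_sub dsim => // e /mapP[f fF ->]; rewrite mem_cat.
case: (altP (coef i f =P 0)) => f0.
  by rewrite !lin_update_const // levsP // rest_in.
rewrite !lin_update_root // !levZ //; apply/orP; right.
by apply/mapP; eexists; first exact: rootP fF f0.
Qed.

(** One implication suffices, since [agree] is symmetric. *)
Definition finitary X := exists D F, forall v w, agree D F v w -> X v -> X w.

Lemma finitary_ext X Y : (forall v, X v <-> Y v) -> finitary X -> finitary Y.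
Proof. by move=> XY [D [F XF]]; exists D, F => v w /XF vw /XY/vw/XY. Qed.

Lemma finitary2 (op : Prop -> Prop -> Prop) X Y :
  (forall A A' B B' : Prop, (A <-> A') -> (B <-> B') -> op A B -> op A' B') ->
  finitary X -> finitary Y -> finitary (fun v => op (X v) (Y v)).
Proof.
move=> opP [D1 [F1 X1]] [D2 [F2 X2]]; exists (maxn D1 D2), (F1 ++ F2) => v w vw.
have vw1 : agree D1 F1 v w.
  by apply: agree_sub vw; rewrite ?leq_maxl // => f fF; rewrite mem_cat fF.
have vw2 : agree D2 F2 v w.
  by apply: agree_sub vw; rewrite ?leq_maxr // => f fF; rewrite mem_cat fF orbT.
by apply: opP; split; [apply: X1|apply: X1|apply: X2|apply: X2] => //; apply: agree_sym.
Qed.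

Lemma finitary_imp X Y : finitary X -> finitary Y -> finitary (fun v => X v -> Y v).
Proof. by apply: (finitary2 (op := fun A B => A -> B)); tauto. Qed.

Lemma finitary_and X Y : finitary X -> finitary Y -> finitary (fun v => X v /\ Y v).
Proof. by apply: (finitary2 (op := and)); tauto. Qed.

Lemma finitary_or X Y : finitary X -> finitary Y -> finitary (fun v => X v \/ Y v).
Proof. by apply: (finitary2 (op := or)); tauto. Qed.

Lemma finitary_False : finitary (fun=> False).
Proof. by exists 0%N, [::]. Qed.

Lemma finitary_ex i X : finitary X -> finitary (fun v => exists c, X (update v i c)).
Proof.
move=> [D [F XF]]; exists (2 * D + 3)%N, (step_terms i F) => v w vw [c Xc].
by have [d /XF cd] := agree_step c vw; exists d; apply: cd.
Qed.

Lemma finitary_all i X : finitary X -> finitary (fun v => forall c, X (update v i c)).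
Proof.
move=> [D [F XF]]; exists (2 * D + 3)%N, (step_terms i F) => v w vw Xv d.
by have [c /agree_sym/XF dc] := agree_step d (agree_sym vw); apply: dc.
Qed.

Lemma finitary_lt s t : finitary (fun v => lin v s < lin v t).
Proof.
exists 0%N, [:: Minus t s] => v w [/(_ _ (mem_head _ _))[+ _] _].
by rewrite !lin_Minus !sub_gt0E => ->.
Qed.

Lemma finitary_eq s t : finitary (fun v => lin v s = lin v t).
Proof.
exists 0%N, [:: Minus t s] => v w [/(_ _ (mem_head _ _))[+ +] _].
rewrite !lin_Minus !sub_gt0E !sub_lt0E => lt1 lt2 e.
by case: (qltgtP (lin w s) (lin w t)) lt1 lt2 => // _; rewrite e ltxx.
Qed.

Lemma finitary_P t : finitary (fun v => P (lin v t)).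
Proof.
exists 0%N, [:: t] => v w [_ [sp _]]; rewrite !(par_lev L).
by have /= -> := sp _ (levsP v w (mem_head t [::])).
Qed.

Lemma finitary_subst (sigma : nat -> term) X :
  finitary X -> finitary (fun v => X (fun j => lin v (sigma j))).
Proof.
move=> [D [F XF]]; exists D, [seq tsubst sigma f | f <- F] => v w [sg sm].
apply: XF; split=> [f fF|].
  by rewrite -!lin_tsubst; apply: sg; apply: map_f.
apply: similar_sub sm => // e /mapP[f fF ->]; rewrite -!lin_tsubst.
by apply: levsP; apply: map_f.
Qed.

(** When x is strictly nearer to p than to q, its distance to q is that of p to q.
    So comparing the two distances of x amounts to membership in a fixed ball
    around p. *)
Lemma lev_cmpS n p q x :
  (iter n.+1 suc (lev (x - p)) <= lev (x - q)) =
  (iter n.+1 suc (lev (x - p)) <= lev (p - q)).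
Proof.
case: (ltP (lev (x - p)) (lev (x - q))) => [lt1|le1].
  by rewrite (@lev_tri_lt _ _ _ L p x q) // lev_subC.
have noS g : g <= lev (x - p) -> (iter n.+1 suc (lev (x - p)) <= g) = false.
  move=> gle; apply/negbTE; rewrite -ltNge iterS; apply: (le_lt_trans gle).
  exact: le_lt_trans (le_iter_suc L n _) (lt_suc L _).
rewrite noS //; case: (ltP (lev (x - p)) (lev (p - q))) => [lt2|/noS //].
by have := le_lt_trans le1 lt2; rewrite (lev_tri_lt lt2) ltxx.
Qed.

Lemma tame_cmp_far n p q :
  tame P 2 (fun x y => (iter n.+1 suc (lev (x - p)) <= lev (x - q)) =
                       (iter n.+1 suc (lev (y - p)) <= lev (y - q))).
Proof.
have Udown g h : g <= h -> iter n.+1 suc h <= lev (p - q) ->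
    iter n.+1 suc g <= lev (p - q).
  by move=> gh; apply: le_trans; rewrite iter_suc_le2.
by apply: tame_sub (tame_ball L p Udown) => // x y; rewrite !lev_cmpS.
Qed.

(** For n = 0 the two sides are exchanged, which turns the weak inequality into the
    negation of a strict one. *)
Lemma tame_cmp n p q :
  tame P 2 (fun x y => (iter n suc (lev (x - p)) <= lev (x - q)) =
                       (iter n suc (lev (y - p)) <= lev (y - q))).
Proof.
case: n => [|n]; last exact: tame_cmp_far.
apply: tame_sub (tame_cmp_far 0 q p) => // x y /=.
by rewrite !(suc_leE L) !leNgt => ->.
Qed.

Lemma tame_const K (R : V -> V -> Prop) : (forall x y, R x y) -> tame P K R.
Proof. by move=> RR; exists [::], [::]; split. Qed.

Lemma tame_sign u i f :
  tame P 2 (fun x y =>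
    (0 < lin (update u i x) f) = (0 < lin (update u i y) f) /\
    (lin (update u i x) f < 0) = (lin (update u i y) f < 0)).
Proof.
case: (altP (coef i f =P 0)) => f0.
  by apply: tame_const => x y; rewrite !lin_update_const.
set p := lin u (root_term i f).
have lt_down : downset (fun x => x < p) by move=> x y; apply: le_lt_trans.
have le_down : downset (fun x => x <= p) by move=> x y; apply: le_trans.
apply: tame_sub (tame_and (tame_downset P lt_down) (tame_downset P le_down)) => //.
move=> x y [lt_xy le_xy]; rewrite !lin_update_root //.
have gt_xy : (p < x) = (p < y) by rewrite !qltNge le_xy.
move: f0; case: (ltgtP (coef i f) 0) => // cf _; last first.
  by rewrite !scale_gt0E // !scale_lt0E // !sub_gt0E !sub_lt0E.
by rewrite !scale_neg_gt0E // !scale_neg_lt0E // !sub_gt0E !sub_lt0E.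
Qed.

Lemma tame_par u i f :
  tame P 4 (fun x y => par (lev (lin (update u i x) f)) =
                       par (lev (lin (update u i y) f))).
Proof.
case: (altP (coef i f =P 0)) => f0.
  by apply: tame_const => x y; rewrite !lin_update_const.
apply: tame_sub (tame_color P (lin u (root_term i f))) => // x y.
by rewrite !lin_update_root // !levZ // !(par_lev L).
Qed.

Lemma tame_lev u i f g n :
  tame P 2 (fun x y =>
    (iter n suc (lev (lin (update u i x) f)) <= lev (lin (update u i x) g)) =
    (iter n suc (lev (lin (update u i y) f)) <= lev (lin (update u i y) g))).
Proof.
case: (altP (coef i f =P 0)) => f0; case: (altP (coef i g =P 0)) => g0.
- by apply: tame_const => x y; rewrite !lin_update_const.
- have Udown h h' : h <= h' -> h' < iter n suc (lev (lin u (rest_term i f))) ->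
      h < iter n suc (lev (lin u (rest_term i f))) by apply: le_lt_trans.
  apply: tame_sub (tame_ball L (lin u (root_term i g)) Udown) => // x y.
  by rewrite !(lin_update_const _ _ f0) !(lin_update_root _ _ g0) !levZ // !leNgt => ->.
- have Udown h h' : h <= h' -> iter n suc h' <= lev (lin u (rest_term i g)) ->
      iter n suc h <= lev (lin u (rest_term i g)).
    by move=> hh; apply: le_trans; rewrite iter_suc_le2.
  apply: tame_sub (tame_ball L (lin u (root_term i f)) Udown) => // x y.
  by rewrite !(lin_update_const _ _ g0) !(lin_update_root _ _ f0) !levZ.
- set p := lin u (root_term i f); set q := lin u (root_term i g).
  apply: tame_sub (tame_cmp n p q) => // x y.
  by rewrite !lin_update_root // !levZ.
Qed.

(** With all the other variables fixed, the conditions in [agree] on the variable i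
    are cuts, balls and translates of P centred at the roots of the terms.  Their
    number depends on the terms only, hence the uniform bound. *)
Lemma finitary_tame X i : finitary X ->
  exists N, forall u, tame P N (fun x y => X (update u i x) -> X (update u i y)).
Proof.
move=> [D [F XF]]; eexists => u.
have ts : tame P _ (fun x y => forall f, f \in F -> _) :=
  tame_all (fun f _ => tame_sign u i f).
have tp : tame P _ (fun x y => forall f, f \in F -> _) :=
  tame_all (fun f _ => tame_par u i f).
have tl : tame P _ (fun x y => forall f, f \in F -> forall g, g \in F ->
    forall n, n \in iota 0 D.+1 -> _) :=
  tame_all (fun f _ => tame_all (fun g _ => tame_all (fun n _ => tame_lev u i f g n))).
apply: tame_sub (tame_and ts (tame_and tp tl)) => [|x y [sg [sp sl]]].
  exact: leqnn.
apply: XF; split; first exact: sg.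
split=> [e /mapP[f fF ->]|e e' n /mapP[f fF ->] /mapP[g gF ->] nD] /=.
  exact: sp.
by apply: sl; rewrite // mem_iota.
Qed.

End Finitary.

(** * The components of P form a system of levels *)

Section Components.
Context (V : orderedQmodType) (P : V -> bool).
Implicit Types (x y z a b : V) (p q : rat).

(** Membership in a common component. *)
Definition linked x y : bool :=
  `[< forall z, (x <= z <= y) || (y <= z <= x) -> P z = P x >].

(** Exactly one alternation of P between x and y: past an element u whose
    colour differs from that of x, the colour does not change again up to y. *)
Definition adjacent x y : Prop :=
  [/\ x < y, P y = ~~ P x &
      forall u w, x < u -> u < w -> w <= y -> P u = ~~ P x -> P w = ~~ P x].

Lemma linkedP x y :
  reflect (forall z, (x <= z <= y) || (y <= z <= x) -> P z = P x) (linked x y).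
Proof. exact: asboolP. Qed.

Lemma linked_refl x : linked x x.
Proof. by apply/linkedP => z; rewrite orbb => /le_anti ->. Qed.

Lemma linked_P x y : linked x y -> P y = P x.
Proof.
by move=> /linkedP; apply; rewrite lexx !andbT; apply: comparable_all.
Qed.

Lemma linked_sym x y : linked x y = linked y x.
Proof.
suff W u w : linked u w -> linked w u by apply/idP/idP; apply: W.
move=> uw; apply/linkedP => z; rewrite orbC => zuw.
by rewrite (linked_P uw); apply: (linkedP _ _ uw).
Qed.

Lemma linked_trans y x z : linked x y -> linked y z -> linked x z.
Proof.
move=> xy yz; apply/linkedP => w wxz.
have [h|h] : ((x <= w <= y) || (y <= w <= x)) \/ ((y <= w <= z) || (z <= w <= y)).
  by case/orP: wxz => /andP[-> ->]; rewrite ?andbT; case: (qltgtP w y) => _;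
    rewrite ?orbT; auto.
  exact: (linkedP _ _ xy).
by rewrite -(linked_P xy); apply: (linkedP _ _ yz).
Qed.

Lemma linked_between x y z : x <= y -> y <= z -> linked x z -> linked x y.
Proof.
move=> xy yz /linkedP xz; apply/linkedP => w /orP[/andP[xw wy]|/andP[yw wx]].
  by apply: xz; rewrite xw (le_trans wy yz).
by congr P; apply/le_anti; rewrite wx (le_trans xy yw).
Qed.

Context (PN : forall x, P (- x) = P x).
Context (near0 : exists2 x, 0 < x & linked 0 x).
Context (linked_comb : forall p q x y, 0 < p -> 0 < q -> x <= y ->
  linked x y -> linked (p *: x + q *: y) x).
Context (adjacent_right : forall x, 0 < x -> exists y, adjacent x y).
Context (adjacent_left : forall x, 0 < x -> exists y, adjacent y x).

Lemma linked_scale q x : 0 < q -> linked (q *: x) x.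
Proof.
move=> q0; have q20 : 0 < q / 2 by rewrite divr_gt0.
have := linked_comb q20 q20 (lexx x) (linked_refl x).
by rewrite -scalerDl -splitr.
Qed.

(** For 0 <= x <= y, the sum lies between y and 2 y, which are linked. *)
Lemma linked_add x y : 0 <= x -> x <= y -> linked (x + y) y.
Proof.
move=> x0 xy; rewrite linked_sym; apply: (@linked_between _ _ (2 *: y)).
- by rewrite -[X in X <= _]add0r leD2rE.
- by rewrite scaler_nat mulr2n leD2rE.
- by rewrite linked_sym linked_scale.
Qed.

Definition qabs x := if 0 <= x then x else - x.

Lemma qabs_ge0 x : 0 <= qabs x.
Proof. by rewrite /qabs; case: (qleP 0 x) => // /ltW; rewrite opp_ge0E. Qed.

Lemma qabs_id x : 0 <= x -> qabs x = x.
Proof. by rewrite /qabs => ->. Qed.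

Lemma qabsN x : qabs (- x) = qabs x.
Proof.
rewrite /qabs opp_ge0E; case: (qltgtP 0 x) => [_||<-] //=.
  by rewrite opprK.
by rewrite oppr0.
Qed.

Lemma qabsZ q x : 0 < q -> qabs (q *: x) = q *: qabs x.
Proof.
move=> q0; rewrite /qabs !qleNgt scale_lt0E //.
by case: ifP; rewrite ?scalerN.
Qed.

Lemma P_qabs x : P (qabs x) = P x.
Proof. by rewrite /qabs; case: ifP; rewrite ?PN. Qed.

(** A nonnegative representative of the component of |x|, chosen from the component
    alone, so that levels can be compared as elements of V. *)
Definition rep x : V := choose (fun y => (0 <= y) && linked y (qabs x)) (qabs x).

Lemma repP x : 0 <= rep x /\ linked (rep x) (qabs x).
Proof.
apply/andP; apply: (@chooseP _ (fun y => (0 <= y) && linked y (qabs x))).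
by rewrite qabs_ge0 linked_refl.
Qed.

Lemma repE x y : 0 <= x -> 0 <= y -> (rep x == rep y) = linked x y.
Proof.
move=> x0 y0; apply/eqP/idP => [e|xy].
  have [_] := repP x; have [_] := repP y; rewrite e !qabs_id // linked_sym => yx xy.
  by rewrite linked_sym; apply: linked_trans yx xy.
rewrite /rep !qabs_id //.
have ext : (fun z => (0 <= z) && linked z x) =1 (fun z => (0 <= z) && linked z y).
  move=> z; congr andb; apply/idP/idP => h; first exact: linked_trans h xy.
  by apply: linked_trans h _; rewrite linked_sym.
rewrite (eq_choose ext) //; apply: choose_id; rewrite ?x0 ?y0 ?linked_refl //.
Qed.

Lemma rep_id x : rep (rep x) = rep x.
Proof.
have [r0 rx] := repP x.
have -> : rep x = rep (qabs x) by rewrite /rep (qabs_id (qabs_ge0 _)).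
apply/eqP; rewrite repE ?qabs_ge0 //; last by case: (repP (qabs x)).
by have [_] := repP (qabs x); rewrite (qabs_id (qabs_ge0 _)).
Qed.

(** Components are convex: two components whose representatives are ordered one
    way cannot have other elements ordered the other way. *)
Lemma le_rep x y : 0 <= x -> x <= y -> rep x <= rep y.
Proof.
move=> x0 xy; have y0 := le_trans x0 xy; rewrite qleNgt; apply/negP => yx.
have [rx0] := repP x; have [ry0] := repP y; rewrite !qabs_id // => ry rx.
suff : linked x y by rewrite -repE // => /eqP e; rewrite e ltxx in yx.
case: (qleP (rep y) x) => [ryx|xry].
  by apply: (linked_trans _ ry); rewrite linked_sym; apply: linked_between ryx xy ry.
apply: (linked_trans _ ry); apply: (@linked_between _ _ (rep x)); rewrite ?ltW //.
by rewrite linked_sym.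
Qed.

Definition component := {g : V | rep g == g}.

Lemma component_compare (g h : component) : (val g <= val h) || (val h <= val g).
Proof. exact: comparable_all. Qed.

HB.instance Definition _ := SubType.on component.
HB.instance Definition _ := [Choice of component by <:].
HB.instance Definition _ :=
  [SubChoice_isSubPOrder of component by <: with ring_display].
HB.instance Definition _ := Order.POrder_isTotal.Build ring_display component
  component_compare.

Definition component_of x : component :=
  exist _ (rep x) (introT eqP (rep_id x)).

Lemma component_of_abs x : component_of (qabs x) = component_of x.
Proof. by apply: val_inj; rewrite /= /rep (qabs_id (qabs_ge0 _)). Qed.

Lemma component_eq x y : 0 <= x -> 0 <= y ->
  (component_of x == component_of y) = linked x y.
Proof. by move=> x0 y0; rewrite -repE. Qed.

Lemma le_component x y : 0 <= x -> x <= y -> component_of x <= component_of y.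
Proof. exact: le_rep. Qed.

Lemma component_val (g : component) : component_of (val g) = g.
Proof. by apply: val_inj; apply/eqP; apply: (valP g). Qed.

Lemma component_val_ge0 (g : component) : 0 <= val g.
Proof. by rewrite -(eqP (valP g)); case: (repP (val g)). Qed.

Lemma component_onto (g : component) : exists2 x, 0 < x & component_of x = g.
Proof.
have := component_val_ge0 g; case: (qltgtP 0 (val g)) => // [g0 _|g0 _].
  by exists (val g); rewrite ?component_val.
have [x x0 lx] := near0; exists x => //; rewrite -[RHS]component_val -g0.
by apply/eqP; rewrite component_eq ?(ltW x0) // linked_sym.
Qed.

Lemma component_add x y : 0 <= x -> 0 <= y ->
  component_of (x + y) = Order.max (component_of x) (component_of y).
Proof.
wlog xy : x y / x <= y.
  move=> W x0 y0; case: (qleP x y) => [xy|/ltW yx]; first exact: W.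
  by rewrite addrC maxC W.
move=> x0 y0; rewrite max_r ?le_component //.
by apply/eqP; rewrite component_eq ?linked_add // (le_trans y0) // -{1}(add0r y) leD2rE.
Qed.

(** Nothing lies strictly between the components of x and y.  A point z between x
    and y which is not linked to x comes after a change of colour, so it has the
    colour of y, and by adjacency so does everything from z to y. *)
Lemma adjacent_cover x y : 0 <= x -> adjacent x y ->
  component_of x < component_of y /\
  forall g, component_of x < g -> component_of y <= g.
Proof.
move=> x0 [xy Pxy alt]; have y0 := le_trans x0 (ltW xy); split.
  rewrite lt_neqAle (le_component x0 (ltW xy)) andbT component_eq //.
  by apply/negP => /linked_P; rewrite Pxy; case: (P x).
move=> g; have [z z0 <-] := component_onto g => xz.
have {}xz : x < z /\ ~~ linked x z.
  split; last by rewrite -component_eq ?(ltW z0) // lt_eqF.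
  by rewrite qltNge; apply/negP => zx; move: xz; rewrite ltNge le_component // ltW.
case: xz => xz nxz; case: (qleP y z) => yz; first exact: le_component.
have Pz : P z = ~~ P x.
  apply/eqP; apply: contraNT nxz => Pz; apply/linkedP => t.
  case/orP => /andP[xt tz]; last first.
    by have := lt_le_trans xz (le_trans xt tz); rewrite ltxx.
  apply/eqP; apply: contraNT Pz => Pt; apply/eqP.
  move: xt tz; rewrite !le_eqVlt => /predU1P[xt|xt] /predU1P[tz|tz].
  - by rewrite xt eqxx in Pt.
  - by rewrite xt eqxx in Pt.
  - by rewrite -tz; case: (P t) (P x) Pt => [] [].
  - by apply: (alt t z) => //; [exact: ltW|case: (P t) (P x) Pt => [] []].
have zy : linked z y.
  apply/linkedP => t; rewrite Pz; case/orP => /andP[zt ty]; last first.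
    by have := lt_le_trans yz (le_trans zt ty); rewrite ltxx.
  move: zt; rewrite le_eqVlt => /predU1P[<- //|zt].
  exact: (alt z t).
rewrite (_ : component_of y = component_of z) //.
by apply/eqP; rewrite component_eq ?(ltW z0) // linked_sym.
Qed.

Lemma component_suc (g : component) : exists h : component,
  [/\ g < h, forall k, g < k -> h <= k & P (val h) = ~~ P (val g)].
Proof.
have [x x0 xg] := component_onto g; have [y xy] := adjacent_right x0.
have [lt_xy cover] := adjacent_cover (ltW x0) xy; exists (component_of y).
rewrite -xg; split => //; case: xy => xy Pxy _.
have vP z : 0 <= z -> P (val (component_of z)) = P z.
  by move=> z0; rewrite -{2}(qabs_id z0); have [_ /linked_P] := repP z.
by rewrite !vP // ltW // (lt_trans x0).
Qed.

(** The element y adjacent to x on the left may be negative.  Then 0 has the colour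
    of y, since otherwise P would change once between y and 0 and again between 0
    and x, and 0 can take the place of y. *)
Lemma component_pred (g : component) : component_of 0 < g ->
  exists h : component, h < g /\ forall k, h < k -> g <= k.
Proof.
have [x x0 <-] := component_onto g => lt0x; have [y yx] := adjacent_left x0.
case: (qleP 0 y) => y0; first by exists (component_of y); apply: adjacent_cover.
exists (component_of 0); apply: adjacent_cover => //.
case: yx => yx Pyx alt.
have P0y : P 0 = P y.
  apply: contraTeq lt0x => Py; rewrite -leNgt le_eqVlt eq_sym component_eq ?(ltW x0) //.
  apply/orP; left; apply/linkedP => t.
  case/orP => /andP[t0 tx]; last first.
    by have := lt_le_trans x0 (le_trans t0 tx); rewrite ltxx.
  move: t0; rewrite le_eqVlt => /predU1P[<- //|t0].
  have P0N : P 0 = ~~ P y by case: (P 0) (P y) Py => [] [].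
  by rewrite P0N; apply: (alt 0 t).
split; rewrite ?P0y // => u w u0 uw wx.
by apply: (alt u w) => //; apply: lt_trans u0.
Qed.

Lemma component_levels : exists G : orderType ring_display, inhabited (levels P G).
Proof.
exists component; have [s sP] := choice component_suc.
have s_pred g : component_of 0 < g -> exists h, g = s h.
  move=> /component_pred[h [hg hmin]]; exists h; have [hs smin _] := sP h.
  by apply/le_anti; rewrite hmin ?smin.
constructor; apply: (@Levels V P component component_of s (fun g => P (val g))) => //.
- exact: component_onto.
- by move=> x; rewrite -component_of_abs qabsN component_of_abs.
- exact: component_add.
- move=> q x q0; rewrite -component_of_abs -[RHS]component_of_abs qabsZ //.
  apply/eqP; rewrite component_eq ?linked_scale ?qabs_ge0 //.
  by rewrite -qabsZ // qabs_ge0.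
- by move=> g; case: (sP g).
- by move=> g h gh; case: (sP g) => _ /(_ h gh).
- by move=> g; case: (sP g).
- by move=> x; rewrite -P_qabs; have [_ /linked_P] := repP x.
Qed.

End Components.

(** * Models of T as ordered rational vector spaces *)

(** An alias of the carrier on which the algebraic structures depend on the proof
    that M is a model. *)
Definition space (M : structure) (_ : models M T) : Type := carrier M.

Section Space.
Context (M : structure) (MT : models M T).
Local Notation V := (space MT).
Implicit Types x y z : V.
Let zero : V := zero_of M.
Let plus : V -> V -> V := @plus_of M.
Let scal : rat -> V -> V := @scal_of M.
Let less : V -> V -> Prop := @lt_of M.

Lemma axiom p : T p -> sat (fun=> zero) p.
Proof. by move=> Tp; apply: MT. Qed.

Lemma space_addA : associative plus.
Proof. by move=> x y z; apply: (axiom T_addA x y z). Qed.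

Lemma space_addC : commutative plus.
Proof. by move=> x y; apply: (axiom T_addC x y). Qed.

Lemma space_add0 : left_id zero plus.
Proof. by move=> x; apply: (axiom T_add0 x). Qed.

Lemma space_scal1 x : scal 1 x = x.
Proof. exact: (axiom T_scal1 x). Qed.

Lemma space_scalDl p q x : scal (p + q) x = plus (scal p x) (scal q x).
Proof. exact: (axiom (T_scalDl p q) x). Qed.

Lemma space_scalDr q x y : scal q (plus x y) = plus (scal q x) (scal q y).
Proof. exact: (axiom (T_scalDr q) x y). Qed.

Lemma space_scalA p q x : scal p (scal q x) = scal (p * q) x.
Proof. by symmetry; apply: (axiom (T_scalA p q) x). Qed.

Lemma space_addI x y z : plus x y = plus x z -> y = z.
Proof.
have [x' /= xx'] := axiom T_addN x; move: xx'.
rewrite /update /= -/plus => xx' xyz.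
have x'x : plus x' x = zero by rewrite space_addC.
by rewrite -(space_add0 y) -(space_add0 z) -x'x -!space_addA xyz.
Qed.

Lemma space_addN : left_inverse zero (scal (-1)) plus.
Proof.
move=> x; rewrite -{2}(space_scal1 x) -space_scalDl addNr.
apply: (@space_addI (scal 0 x)); rewrite -space_scalDl addr0.
by rewrite space_addC space_add0.
Qed.

HB.instance Definition _ := gen_eqMixin V.
HB.instance Definition _ := gen_choiceMixin V.
HB.instance Definition _ :=
  GRing.isZmodule.Build V space_addA space_addC space_add0 space_addN.
HB.instance Definition _ :=
  GRing.Zmodule_isLmodule.Build rat V space_scalA space_scal1
    (fun q x y => space_scalDr q x y) (fun x p q => space_scalDl p q x).

Lemma space_ltxx : irreflexive (fun x y => `[<less x y>]).
Proof. by move=> x; apply/asboolP; apply: (axiom T_ltxx x). Qed.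

Lemma space_lt_trans : transitive (fun x y => `[<less x y>]).
Proof.
move=> y x z /asboolP xy /asboolP yz; apply/asboolP.
exact: (axiom T_lt_trans x y z).
Qed.

HB.instance Definition _ :=
  Order.Lt_isPOrder.Build ring_display V space_ltxx space_lt_trans.

Lemma space_ltP x y : reflect (less x y) (x < y).
Proof. exact: asboolP. Qed.

Lemma space_leP x y : reflect (less x y \/ x = y) (x <= y).
Proof.
rewrite le_eqVlt; apply: (iffP orP) => [[/eqP ->|/space_ltP]|[/space_ltP|->]];
  by [right|left|rewrite eqxx; left].
Qed.

Lemma space_comparable x y : x >=< y.
Proof.
rewrite /Order.comparable; case: (axiom T_lt_total x y) => /= [xy|[xy|yx]].
- by apply/orP; left; apply/space_leP; left.
- by apply/orP; left; apply/space_leP; right.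
- by apply/orP; right; apply/space_leP; left.
Qed.

Lemma space_translate x y z : x < y -> x + z < y + z.
Proof. by move=> /space_ltP xy; apply/space_ltP; apply: (axiom T_lt_add x y z xy). Qed.

HB.instance Definition _ :=
  POrderedLmodule_isTotallyOrdered.Build V space_translate space_comparable.

Definition space_P x : bool := `[< P_of (x : M) >].


Lemma space_PP x : reflect (P_of (x : M)) (space_P x).
Proof. exact: asboolP. Qed.

Lemma space_P0 : space_P 0.
Proof. by apply/space_PP; apply: (axiom T_P0). Qed.

Lemma space_PN x : space_P (- x) = space_P x.
Proof.
have [/= PN NP] := axiom T_PN x.
by apply/space_PP/space_PP => [/NP|/PN].
Qed.

(** As P is open at 0, half of the right end of an interval around 0 is a positive
    element of the component of 0. *)
Lemma space_near0 : exists2 x : V, 0 < x & linked space_P 0 x.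
Proof.
have [y [z [[/= /space_ltP y0 /space_ltP z0] Pyz]]] := axiom T_P_open zero (axiom T_P0).
have half_gt0 : 0 < 2^-1 :> rat by [].
have x0 : 0 < 2^-1 *: (z : V) by rewrite scale_gt0E.
have xz : 2^-1 *: (z : V) < z by apply: half_lt.
exists (2^-1 *: (z : V)) => //; apply/linkedP => w.
case/orP => /andP[w0 wx]; last first.
  by have := lt_le_trans x0 (le_trans w0 wx); rewrite ltxx.
rewrite space_P0; apply/space_PP; apply: Pyz; split; apply/space_ltP.
  exact: lt_le_trans y0 w0.
exact: le_lt_trans wx xz.
Qed.

Lemma space_comb p q x y : 0 < p -> 0 < q -> x <= y ->
  linked space_P x y -> linked space_P (p *: x + q *: y) x.
Proof.
move=> p0 q0 /space_leP xy /linkedP xyP; rewrite linked_sym.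
have in_xy w : (less x w \/ x = w) /\ (less w y \/ w = y) -> space_P w = space_P x.
  by move=> [/space_leP xw /space_leP wy]; apply: xyP; rewrite xw wy.
set z := p *: x + q *: y.
have segment w : (x <= w <= z) || (z <= w <= x) ->
    ((less z x \/ z = x) /\ ((less z w \/ z = w) /\ (less w x \/ w = x))) \/
    ((less x z \/ x = z) /\ ((less x w \/ x = w) /\ (less w z \/ w = z))).
  case/orP => /andP[h1 h2]; [right|left]; have h3 := le_trans h1 h2;
    by split; [|split]; apply/space_leP.
apply/linkedP => w /segment.
case: (boolP (space_P x)) => Px.
  have all_P w' : (less x w' \/ x = w') /\ (less w' y \/ w' = y) -> P_of (w' : M).
    by move=> /in_xy; rewrite Px => /space_PP.
  have [[/= zx xz] _] := axiom (T_P_comb p0 q0) x y (conj xy all_P).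
  by move=> [[/zx h /h]|[/xz h /h]] /space_PP ->.
have all_NP w' : (less x w' \/ x = w') /\ (less w' y \/ w' = y) -> ~ P_of (w' : M).
  by move=> /in_xy e /space_PP; rewrite e; apply/negP.
have [[/= zx xz] _] := axiom (T_NotP_comb p0 q0) x y (conj xy all_NP).
by move=> [[/zx h /h]|[/xz h /h]] /space_PP /negbTE ->.
Qed.

Lemma space_adjacent x y : R_of 1 (x : M) (y : M) -> adjacent space_P x y.
Proof.
have [/= R1 _] := axiom (T_Rn (isT : (0 < 1)%N)) x y.
move=> /R1 [/space_ltP xy]; rewrite /update /=.
case=> [[/space_PP Px [[x0 [x1 [[e0 e1] [_ [_ [Py _]]]]]] noalt]]|].
  have Py' : ~~ space_P y by apply/space_PP; rewrite -e1.
  split=> // [|u w xu uw wy Pu]; first by rewrite Px (negbTE Py').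
  rewrite Px; apply/negbTE/negP => Pw; apply: noalt; exists x, u, w.
  split; first by split=> //; apply/space_leP.
  split; first by split; [apply/space_ltP|split; [apply/space_ltP|]].
  split; first exact/space_PP.
  split; first by apply/space_PP; rewrite Pu Px.
  by split; first exact/space_PP.
move=> [/space_PP Px [[x0 [x1 [[e0 e1] [_ [_ [Py _]]]]]] noalt]].
have Py' : space_P y by apply/space_PP; rewrite -e1.
split=> // [|u w xu uw wy Pu]; first by rewrite Py' Px.
rewrite Px; apply/negPn/negP => Pw; apply: noalt; exists x, u, w.
split; first by split=> //; apply/space_leP.
split; first by split; [apply/space_ltP|split; [apply/space_ltP|]].
split; first by move=> /space_PP; apply/negP.
split; first by apply/space_PP; rewrite Pu.
by split; first by move=> /space_PP; apply/negP.
Qed.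

Lemma space_adjacent_right x : 0 < x -> exists y, adjacent space_P x y.
Proof.
move=> /space_ltP x0; have [y /space_adjacent xy] := axiom T_R1_right x x0.
by exists y.
Qed.

Lemma space_adjacent_left x : 0 < x -> exists y, adjacent space_P y x.
Proof.
move=> /space_ltP x0; have [y /space_adjacent xy] := axiom T_R1_left x x0.
by exists y.
Qed.

Lemma space_levels : exists G : orderType ring_display, inhabited (levels space_P G).
Proof.
exact: (component_levels space_PN space_near0 space_comb
  space_adjacent_right space_adjacent_left).
Qed.

Lemma eval_lin (v : nat -> V) t : eval (v : nat -> M) t = lin v t.
Proof. by elim: t => //= [s -> t ->|q t ->]. Qed.

End Space.

(** * Formulas are finitely determined *)

Fixpoint rel_free (p : formula) : bool :=
  match p with
  | Rel _ _ _ => false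
  | Imp p q | And p q | Or p q => rel_free p && rel_free q
  | All _ p | Ex _ p => rel_free p
  | _ => true
  end.

Lemma rel_free_Conj (A : Type) (F : A -> formula) (s : seq A) :
  (forall x, rel_free (F x)) -> rel_free (Conj (map F s)).
Proof. by move=> FF; elim: s => //= x s ->; rewrite FF. Qed.

Lemma rel_free_Exs xs p : rel_free (Exs xs p) = rel_free p.
Proof. by elim: xs. Qed.

Lemma rel_free_Alternates b n (e : term -> formula) :
  (forall t, rel_free (e t)) -> rel_free (Alternates b n e).
Proof.
move=> eP; rewrite /Alternates rel_free_Exs.
set lts := Conj _; set colors := Conj _.
rewrite -[rel_free _]/[&& rel_free (e (Var (seq_var n))), rel_free lts
  & rel_free colors].
by rewrite eP !rel_free_Conj // => i; case: ifP.
Qed.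

(** The definition of R_n that the axioms give, in the variables 0 and 1.  For n = 0
    the axiom speaks of x <= y only, and symmetry gives the second disjunct. *)
Definition rel_formula (n : nat) : formula :=
  if n == 0%N then
    Or (And (Le (Var 0) (Var 1)) (Or (IntervalIn InP (Var 0) (Var 1))
                                     (IntervalIn NotP (Var 0) (Var 1))))
       (And (Le (Var 1) (Var 0)) (Or (IntervalIn InP (Var 1) (Var 0))
                                     (IntervalIn NotP (Var 1) (Var 0))))
  else ExactAlternations n.

Lemma rel_free_rel_formula n : rel_free (rel_formula n).
Proof.
rewrite /rel_formula; case: eqP => // _.
pose at_y t := Eq t (Var 1); pose below_y t := Le t (Var 1).
rewrite -[rel_free _]/[&& rel_free (Alternates false n at_y)
    && (rel_free (Alternates false n.+1 below_y) && true)
  & rel_free (Alternates true n at_y)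
    && (rel_free (Alternates true n.+1 below_y) && true)].
by rewrite !rel_free_Alternates.
Qed.

Lemma sat_rel_formula (M : structure) (v : nat -> M) n x y : models M T ->
  R_of n x y <-> sat (update (update v 0 x) 1 y) (rel_formula n).
Proof.
move=> MT; rewrite /rel_formula; case: posnP => [->|n0]; last first.
  have [R1 R2] := MT _ (T_Rn n0) v x y; split; [exact: R1|exact: R2].
have R0 := MT _ T_R0 v; have sym := MT _ T_R0_sym v.
rewrite /update /= in R0 sym *; split.
  move=> xy; case: (MT _ T_lt_total v x y) => /= [lt|[e|lt]].
  - by left; split; [left|apply: (R0 x y (or_introl lt)).1].
  - by left; split; [right|apply: (R0 x y (or_intror e)).1].
  - by right; split; [left|apply: (R0 y x (or_introl lt)).1; apply: sym].
by case=> [[xy]|[yx]] h; [apply: (R0 x y xy).2|apply/sym/(R0 y x yx).2].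
Qed.

Section FinitarySat.
Context (M : structure) (MT : models M T) (G : orderType ring_display).
Context (L : levels (space_P (MT := MT)) G).
Local Notation finitary := (finitary L).

Lemma finitary_rel_free p : rel_free p ->
  finitary (fun v => sat (v : nat -> M) p).
Proof.
elim: p => //=.
- by move=> _; apply: finitary_False.
- move=> s t _; apply: finitary_ext (finitary_eq L s t) => v.
  by rewrite !eval_lin.
- move=> s t _; apply: finitary_ext (finitary_lt L s t) => v.
  by rewrite !eval_lin; split => /space_ltP.
- move=> t _; apply: finitary_ext (finitary_P L t) => v.
  by rewrite eval_lin; split => /space_PP.
- by move=> p IHp q IHq /andP[/IHp pF /IHq qF]; apply: finitary_imp.
- by move=> p IHp q IHq /andP[/IHp pF /IHq qF]; apply: finitary_and.
- by move=> p IHp q IHq /andP[/IHp pF /IHq qF]; apply: finitary_or.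
- by move=> i p IH /IH; apply: finitary_all.
- by move=> i p IH /IH; apply: finitary_ex.
Qed.

(** An atomic formula R_n(s, t) is replaced by the defining formula of R_n, with s
    and t substituted for its two free variables. *)
Lemma finitary_sat p : finitary (fun v => sat (v : nat -> M) p).
Proof.
elim: p => [|s t|s t|t|n s t|p IHp q IHq|p IHp q IHq|p IHp q IHq|i p IH|i p IH];
  try exact: finitary_rel_free.
- have fin := finitary_subst (update (update Var 0 s) 1 t)
    (finitary_rel_free (rel_free_rel_formula n)).
  apply: (finitary_ext _ fin) => v /=.
  rewrite (sat_rel_formula v) // !eval_lin.
  rewrite (_ : (fun j => _) = update (update v 0 (lin v s)) 1 (lin v t)) //.
  by apply/funext => j; rewrite /update; case: eqP => // _; case: eqP.
- exact: finitary_imp.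
- exact: finitary_and.
- exact: finitary_or.
- exact: (finitary_all i IH).
- exact: (finitary_ex i IH).
Qed.

End FinitarySat.

(** * From patterns to counting *)

Lemma eval_free (M : structure) (v w : nat -> M) t :
  {in term_vars t, v =1 w} -> eval v t = eval w t.
Proof.
elim: t => //= [i|s IHs t IHt|q t IH] vw; first by rewrite vw ?mem_head.
  by rewrite IHs ?IHt // => i it; apply: vw; rewrite mem_cat it ?orbT.
by rewrite IH.
Qed.

Lemma sat_free (M : structure) p (v w : nat -> M) :
  {in free_vars p, v =1 w} -> sat v p <-> sat w p.
Proof.
elim: p v w => //= [s t|s t|t|n s t|p IHp q IHq|p IHp q IHq|p IHp q IHq
                   |i p IH|i p IH] v w vw.
1,2,4: by rewrite !(@eval_free _ v w) // => i it; apply: vw; rewrite mem_cat it ?orbT.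
- by rewrite (@eval_free _ v w).
- rewrite (IHp v w) ?(IHq v w) // => i it; apply: vw; rewrite mem_cat it ?orbT //.
- rewrite (IHp v w) ?(IHq v w) // => i it; apply: vw; rewrite mem_cat it ?orbT //.
- rewrite (IHp v w) ?(IHq v w) // => i it; apply: vw; rewrite mem_cat it ?orbT //.
- have e a : sat (update v i a) p <-> sat (update w i a) p.
    apply: IH => j jp; rewrite /update; case: eqP => // /eqP ji.
    by apply: vw; rewrite mem_filter ji.
  by split=> h a; apply/e.
- have e a : sat (update v i a) p <-> sat (update w i a) p.
    apply: IH => j jp; rewrite /update; case: eqP => // /eqP ji.
    by apply: vw; rewrite mem_filter ji.
  by split=> -[a h]; exists a; apply/e.
Qed.

(** Says p with each variable j of [js] taking the value of the variable z j.  The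
    quantifiers Ex j do the work of a substitution and cannot capture anything,
    as long as no z j is itself in [js]. *)
Definition read_from (js : seq nat) (z : nat -> nat) (p : formula) : formula :=
  foldr (fun j q => Ex j (And (Eq (Var j) (Var (z j))) q)) p js.

Lemma sat_read_from (M : structure) js z p (v : nat -> M) :
  {in js, forall j, z j \notin js} ->
  sat v (read_from js z p) <->
  sat (fun i => if i \in js then v (z i) else v i) p.
Proof.
elim: js v => //= j js IH v zjs.
have zj : z j != j by have := zjs j (mem_head _ _); rewrite inE negb_or => /andP[].
rewrite -/(read_from js z p).
have zjs' : {in js, forall i, z i \notin js}.
  move=> i ijs; have := zjs i; rewrite inE ijs orbT => /(_ isT).
  by rewrite inE negb_or => /andP[].
set u := update v j (v (z j)).
have e : (fun i => if i \in js then u (z i) else u i) =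
    (fun i => if i \in j :: js then v (z i) else v i).
  apply/funext => i; rewrite inE /u /update; case: (boolP (i \in js)) => ijs.
    have := zjs i; rewrite inE ijs orbT => /(_ isT).
    by rewrite inE negb_or => /andP[/negbTE->].
  by case: eqP => [->|].
rewrite -e -(IH _ zjs'); split.
  by move=> [c]; rewrite {1 2}/update eqxx (negbTE zj) => -[-> ].
by move=> h; exists (v (z j)); rewrite {1 2}/update eqxx (negbTE zj).
Qed.

Lemma sat_Conj (M : structure) (v : nat -> M) (A : eqType) (F : A -> formula) s :
  sat v (Conj (map F s)) <-> forall x, x \in s -> sat v (F x).
Proof.
elim: s => [|x s IH] /=; first by split=> // _ [].
rewrite IH; split=> [[Fx Fs] y|Fs].
  by rewrite inE => /predU1P[->|/Fs].
split; first exact/Fs/mem_head.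
by move=> y ys; apply: Fs; rewrite inE ys orbT.
Qed.

Lemma holds_at_update (M N : structure) (f : M -> N) k p c (a : k.-tuple M) d :
  formula_in k p ->
  holds_at f p c a <-> sat (update (fun i => nth d (d :: map f a) i) 0 c) p.
Proof.
move=> pk; apply: sat_free => i /pk; rewrite mem_iota add0n => /andP[_ ik].
by case: i ik => // i ik; apply: set_nth_default; rewrite /= size_map size_tuple.
Qed.

Section Transfer.
Context (M : structure) (x0 : M) (k : nat) (tup : nat -> k.-tuple M).

(** One assignment that holds all the tuples at once: entry j of tuple q, counted
    from 1, is the value of the variable q * (k + 1) + j.  Block 0 consists of the
    variables that a formula in k parameters uses itself. *)
Definition blocks (m : nat) : M :=
  nth x0 (x0 :: tup (m %/ k.+1)) (m %% k.+1).

Definition at_block (q : nat) (p : formula) : formula :=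
  read_from (iota 1 k) (fun j => q * k.+1 + j)%N p.

Lemma sat_at_block (N : structure) (f : M -> N) c q p :
  (0 < q)%N -> formula_in k p ->
  sat (update (f \o blocks) 0 c) (at_block q p) <-> holds_at f p c (tup q).
Proof.
move=> q0 pk; rewrite sat_read_from; last first.
  move=> j; rewrite !mem_iota => jk; rewrite negb_and -!ltnNge.
  apply/orP; right; nia.
apply: sat_free => i /pk; rewrite !mem_iota add0n => /andP[_ ik].
case: i ik => [|i] ik //=; rewrite add1n ik /= /update.
rewrite addnS /= /blocks -addnS divnMDl // modnMDl divn_small // addn0 modn_small //=.
by rewrite (nth_map x0) // size_tuple.
Qed.
End Transfer.

(** The finitely many conditions on c form one formula with parameters in M, so they
    can be satisfied in M as soon as they are in an elementary extension.  The
    tuples a occupy the odd blocks, the tuples b the positive even ones. *)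
Lemma ICT_realized (M : structure) (x0 : M) (k : nat) (phi psi : formula)
    (a b : nat -> k.-tuple M) :
  ICT_pattern phi psi a b -> forall n i j, exists c : M,
    (forall l, (l < n)%N -> holds_at id phi c (a l) <-> l = i) /\
    (forall m, (m < n)%N -> holds_at id psi c (b m) <-> m = j).
Proof.
move=> [phik psik ict] n i j.
pose tup q := if odd q then a q./2 else b q./2.-1.
pose lit q e p := if e then at_block k q p else Not (at_block k q p).
pose row l := lit l.*2.+1 (l == i) phi; pose col m := lit m.+1.*2 (m == j) psi.
pose Psi := Ex 0 (And (Conj (map row (iota 0 n))) (Conj (map col (iota 0 n)))).
have satP (N : structure) (f : M -> N) c :
    sat (update (f \o blocks x0 tup) 0 c)
      (And (Conj (map row (iota 0 n))) (Conj (map col (iota 0 n)))) <->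
    (forall l, (l < n)%N -> holds_at f phi c (a l) <-> l = i) /\
    (forall m, (m < n)%N -> holds_at f psi c (b m) <-> m = j).
  have litP q e p : (0 < q)%N -> formula_in k p ->
      sat (update (f \o blocks x0 tup) 0 c) (lit q e p) <->
      (holds_at f p c (tup q) <-> e).
    move=> q0 pk; rewrite -(sat_at_block x0 tup f c q0 pk) /lit.
    case: e => /=; split.
    - by move=> h; split.
    - by move=> [_]; apply.
    - by move=> h; split=> // /h.
    - by move=> [h _] /h.
  have tupa l : tup l.*2.+1 = a l by rewrite /tup /= odd_double uphalf_double.
  have tupb m : tup m.+1.*2 = b m by rewrite /tup odd_double doubleK.
  rewrite [sat _ _]/= !sat_Conj; split=> -[h1 h2]; split=> l.
  - move=> ln; have := h1 l; rewrite mem_iota ln => /(_ isT) /litP.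
    by rewrite tupa => -> //; split=> /eqP.
  - move=> ln; have := h2 l; rewrite mem_iota ln => /(_ isT) /litP.
    by rewrite tupb => -> //; split=> /eqP.
  - rewrite mem_iota => ln; apply/litP => //; rewrite tupa h1 //.
    by split=> /eqP.
  - rewrite mem_iota => ln; apply/litP => //; rewrite tupb h2 //.
    by split=> /eqP.
have [N [f [ef [c [phic psic nphi npsi]]]]] := ict i j.
have /ef [c' /(satP M id) c'P] : sat (f \o blocks x0 tup) Psi.
  exists c; apply/satP; split=> l _; split=> [h|->] //.
    by apply: contrapT => /nphi.
  by apply: contrapT => /npsi.
by exists c'.
Qed.

Theorem corollary5p6 : dp_minimal T.
Proof.
move=> M MT [k [phi [psi [a [b ict]]]]].
have [phik psik _] := ict.
have [G [L]] := space_levels MT.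
have [N1 tame1] := finitary_tame 0 (finitary_sat L phi).
have [N2 tame2] := finitary_tame 0 (finitary_sat L psi).
(* With this n, the number n ^ 2 of points exceeds 2 (n N1 + n N2 + 1). *)
pose n := (2 * (N1 + N2) + 3)%N.
pose x0 := zero_of M.
have realized (ij : 'I_n * 'I_n) : exists c : space MT,
    (forall l, (l < n)%N -> holds_at id phi (c : M) (a l) <-> l = ij.1) /\
    (forall m, (m < n)%N -> holds_at id psi (c : M) (b m) <-> m = ij.2).
  exact: (ICT_realized x0 ict n ij.1 ij.2).
have [c cP] := choice realized.
pose env (t : k.-tuple M) i : space MT := nth x0 (x0 :: map id t) i.
have t1 := tame_all (s := iota 0 n) (fun l _ => tame1 (env (a l))).
have t2 := tame_all (s := iota 0 n) (fun l _ => tame2 (env (b l))).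
have := tame_card L (tame_and t1 t2) (c := c).
rewrite card_prod card_ord !size_iota => /(_ _)/wrap[].
  move=> [i j] [i' j'] ne [r1 r2]; case/eqP: ne.
  have [e1 e2] := cP (i, j); have [e1' e2'] := cP (i', j').
  congr pair; apply: val_inj.
    have := r1 i; rewrite mem_iota ltn_ord => /(_ isT).
    rewrite -!(holds_at_update id _ _ x0 phik) => h.
    by apply/(e1' i (ltn_ord i))/h/e1.
  have := r2 j; rewrite mem_iota ltn_ord => /(_ isT).
  rewrite -!(holds_at_update id _ _ x0 psik) => h.
  by apply/(e2' j (ltn_ord j))/h/e2.
rewrite /n; nia.
Qed.
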